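(* Assume that $(X_i)_{i\ge0}$ is stationary with stationary density $\varphi$ with respect to the Lebesgue measure $\mu$ on $\mathbb{R}^d$, and that there exists $\kappa_0>0$ such that $\varphi(x)\ge\kappa_0$ for all $x\in[0,1]^d$. Then for all $\ell\in\mathbb{N}^\star$ and $L\ge L_0$, the estimator $\hat s=\hat s(L,\ell)$ satisfies $$C\,\mathbb{E}\left[h^2(s\mathbf{1}_A,\hat s)\right]\le\inf_{m\in\mathcal{M}_\ell}\left\{h^2(s\mathbf{1}_A,V_m)+\mathrm{pen}(m)\right\}+\frac{R_n(\ell)}{n},$$ where $$R_n(\ell)=n2^{3\ell d}\inf_{1\le q\le n}\left\{\exp\left(-\frac{\kappa_0}{10}\frac{n}{q2^{\ell d}}\right)+n\beta_q/q\right\}$$ and where $C$ is a universal positive constant.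
   Context: Setting. Let $d\ge 1$ and $n>3$ be integers, $\mathbb{N}^\star=\{1,2,\dots\}$. $(X_i)_{i\ge 0}$ is a time-homogeneous Markov chain with values in $\mathbb{X}=\mathbb{R}^d$, endowed with the Lebesgue measure $\mu$. For each $x$, the conditional law of $X_{i+1}$ given $X_i=x$ has a density $s(x,\cdot)$ with respect to $\mu$. The transition density $s$ is to be estimated on $A=[0,1]^{2d}$ from $X_0,\dots,X_n$. ''Universal'' means not depending on any other quantity. Distances. On the cone of non-negative functions on $[0,1]^{2d}$ integrable with respect to $(\varphi\cdot\mu)\otimes\mu$, $$h^2(f,f')=\frac12\int_{[0,1]^{2d}}\left(\sqrt{f(x,y)}-\sqrt{f'(x,y)}\right)^2\varphi(x)\,dx\,dy,$$ and $h(f,V)=\inf_{g\in V}h(f,g)$. With $M=\lambda_n\otimes\mu$, $\lambda_n=n^{-1}\sum_{i=0}^{n-1}\delta_{X_i}$, for non-negative $M$-integrable $f,f'$, $$H^2(f,f')=\frac1{2n}\sum_{i=0}^{n-1}\int_{\mathbb{X}}\left(\sqrt{f(X_i,y)}-\sqrt{f'(X_i,y)}\right)^2 d\mu(y),$$ and $H(f,V)=\inf_{g\in V}H(f,g)$. Mixing coefficients. For $q\in\mathbb{N}^\star$, $\beta_q=\int_{\mathbb{R}^{2d}}|s^{(q)}(x,y)-\varphi(y)|\varphi(x)\,dx\,dy$, where $s^{(q)}(x,\cdot)$ is the density with respect to the Lebesgue measure of the conditional law of $X_q$ given $X_0=x$. Partitions. For $j\in\mathbb{N}$, $\mathcal{K}_j$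 is the set of the $2^{2dj}$ dyadic cubes $\prod_{i=1}^{2d}I_j(l_i)$, $1\le l_i\le 2^j$, where $I_j(l)=[(l-1)2^{-j},l2^{-j})$ if $l<2^j$ and $I_j(2^j)=[(2^j-1)2^{-j},1]$. Start from the partition $\{[0,1]^{2d}\}$; at each step, for each cube of the current partition (belonging to some $\mathcal{K}_j$) one decides to divide it into the $4^d$ elements of $\mathcal{K}_{j+1}$ contained in it, or not. $\mathcal{M}_\ell$ is the set of partitions obtained in at most $\ell$ steps, and $\mathcal{M}_\infty=\bigcup_{\ell\ge1}\mathcal{M}_\ell$. For a partition $m$, $V_m=\{\sum_{K\in m}a_K\mathbf{1}_K:\ a_K\in[0,\infty)\}$, and $$\hat s_m=\sum_{K\in m}\frac{\sum_{i=0}^{n-1}\mathbf{1}_K(X_i,X_{i+1})}{\sum_{i=0}^{n-1}\int\mathbf{1}_K(X_i,x)\,d\mu(x)}\mathbf{1}_K,$$ with $0/0=0$. Selection rule. For $K\in\bigcup_{m\in\mathcal{M}_\ell}m$ and $m'\in\mathcal{M}_\ell$, let $m'\vee K=\{K'\cap K:\ K'\in m',\ K\cap K'\neq\emptyset\}$. For $L>0$ put $\mathrm{pen}(m'\vee K)=L|m'\vee K|\log n/n$ (so $\mathrm{pen}(m)=L|m|\log n/n$). Let $\alpha=(1-1/\sqrt2)/2$ and, with $0/0=0$, $$T(f,f')=\frac1{2n\sqrt2}\sum_{i=0}^{n-1}\int_{\mathbb{X}}\sqrt{f(X_i,y)+f'(X_i,y)}\left(\sqrt{f'(X_i,y)}-\sqrt{f(X_i,y)}\right)d\mu(y)$$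 $$+\frac1{n\sqrt2}\sum_{i=0}^{n-1}\frac{\sqrt{f'(X_i,X_{i+1})}-\sqrt{f(X_i,X_{i+1})}}{\sqrt{f(X_i,X_{i+1})+f'(X_i,X_{i+1})}}+\frac1{2n}\sum_{i=0}^{n-1}\int_{\mathbb{X}}(f(X_i,y)-f'(X_i,y))\,d\mu(y).$$ For $m\in\mathcal{M}_\ell$ let $$\gamma(m)=\sum_{K\in m}\sup_{m'\in\mathcal{M}_\ell}\left[\sum_{K'\in m'}\left(\alpha H^2(\hat s_m\mathbf{1}_{K\cap K'},\hat s_{m'}\mathbf{1}_{K\cap K'})+T(\hat s_m\mathbf{1}_{K\cap K'},\hat s_{m'}\mathbf{1}_{K\cap K'})\right)-\mathrm{pen}(m'\vee K)\right]+2\,\mathrm{pen}(m).$$ $\hat m$ is any element of $\mathcal{M}_\ell$ with $\gamma(\hat m)\le\inf_{m\in\mathcal{M}_\ell}\gamma(m)+1/n$, and $\hat s(L,\ell)=\hat s_{\hat m}$. The constant $L_0$. $L_0>0$ is a universal constant such that, for some universal $C_0>0$, for all such chains and all $L\ge L_0$, $\ell\in\mathbb{N}^\star\cup\{\infty\}$: $C_0\mathbb{E}[H^2(s\mathbf{1}_A,\hat s(L,\ell))]\le\inf_{m\in\mathcal{M}_\ell}\{\mathbb{E}[H^2(s\mathbf{1}_A,V_m)]+\mathrm{pen}(m)\}$. *)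

(* Defs.v *)
(* R^d is [d.-tuple R] with its product sigma-algebra, and R^(2d) is identified
   with [d.-tuple R * d.-tuple R]. *)
From HB Require Import structures.
From mathcomp Require Import all_boot all_order all_algebra finmap.
From mathcomp Require Import all_classical all_reals all_analysis.

Set Implicit Arguments.
Unset Strict Implicit.
Unset Printing Implicit Defensive.
Import Order.TTheory GRing.Theory Num.Theory.
Import numFieldNormedType.Exports.
Local Open Scope classical_set_scope.
Local Open Scope ring_scope.

Section lebesgue_vec.
Context (R : realType).

Definition cons_vec d (z : R * d.-tuple R) : d.+1.-tuple R :=
  [tuple of z.1 :: z.2].

Lemma measurable_cons_vec d : measurable_fun setT (@cons_vec d).
Proof. exact: (measurable_cons measurable_fst measurable_snd). Qed.

Section step.
Context d (mu : {sigma_finite_measure set (d.-tuple R) -> \bar R}).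

Definition lebesgue_cons : set (d.+1.-tuple R) -> \bar R :=
  pushforward (@lebesgue_measure R \x mu)%E (@cons_vec d).

Let lebesgue_cons0 : lebesgue_cons set0 = 0%E.
Proof. by rewrite /lebesgue_cons /pushforward preimage_set0 measure0. Qed.

Let lebesgue_cons_ge0 A : (0 <= lebesgue_cons A)%E.
Proof. by rewrite /lebesgue_cons /pushforward measure_ge0. Qed.

Let lebesgue_cons_sigma_additive : semi_sigma_additive lebesgue_cons.
Proof.
move=> F mF tF mUF; rewrite /lebesgue_cons /pushforward preimage_bigcup.
apply: measure_semi_sigma_additive.
- by move=> n; rewrite -[X in measurable X]setTI; exact: measurable_cons_vec.
- apply/trivIsetP => /= i j _ _ ij; rewrite -preimage_setI.
  by move/trivIsetP : tF => /(_ _ _ _ _ ij) ->//; rewrite preimage_set0.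
- rewrite -preimage_bigcup -[X in measurable X]setTI.
  exact: measurable_cons_vec.
Qed.

HB.instance Definition _ := isMeasure.Build _ _ _
  lebesgue_cons lebesgue_cons0 lebesgue_cons_ge0 lebesgue_cons_sigma_additive.

Let lebesgue_cons_sigma_finite : sigma_finite setT lebesgue_cons.
Proof.
have /sigma_finiteP[F [TF ndF Foo]] := sigma_finiteT (@lebesgue_measure R).
have /sigma_finiteP[G [TG ndG Goo]] := sigma_finiteT mu.
pose uncons := fun t : d.+1.-tuple R => (thead t, [tuple of behead t]).
have munc : measurable_fun setT uncons.
  by apply/measurable_fun_pairP; split;
    [exact: measurable_tnth|exact: measurable_behead].
have consK z : uncons (cons_vec z) = z.
  by case: z => a t; congr pair; exact: val_inj.
exists (fun n => uncons @^-1` (F n `*` G n)).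
  apply/seteqP; split => // t _.
  have [n _ Fn] : (\bigcup_n F n) (uncons t).1 by rewrite -TF.
  have [k _ Gk] : (\bigcup_n G n) (uncons t).2 by rewrite -TG.
  exists (maxn n k) => //; split.
  - by move: Fn; exact/subsetPset/ndF/leq_maxl.
  - by move: Gk; exact/subsetPset/ndG/leq_maxr.
move=> n; have [mF Fn] := Foo n; have [mG Gn] := Goo n; split.
  rewrite -[X in measurable X]setTI; apply: munc => //.
  exact: measurableX.
rewrite /lebesgue_cons /pushforward (_ : _ @^-1` _ = F n `*` G n).
  by rewrite product_measure1E// lte_mul_pinfty// ge0_fin_numE.
by apply/funext => z; rewrite -[in RHS](consK z).
Qed.

HB.instance Definition _ := Measure_isSigmaFinite.Build _ _ _
  lebesgue_cons lebesgue_cons_sigma_finite.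

End step.

Fixpoint lebesgue_vec d : {sigma_finite_measure set (d.-tuple R) -> \bar R} :=
  match d with
  | 0 => @dirac _ (0.-tuple R) [tuple] R
  | d'.+1 => lebesgue_cons (lebesgue_vec d')
  end.

End lebesgue_vec.

Lemma lebesgue_vec_box (R : realType) d (A : 'I_d -> set R) :
  (forall i, measurable (A i)) ->
  lebesgue_vec R d [set t | forall i, A i (tnth t i)] =
  (\prod_(i < d) @lebesgue_measure R (A i))%E.
Proof.
elim: d A => [|d IH] A mA.
  by rewrite big_ord0 /= diracE mem_set// => -[].
rewrite big_ord_recl /= /lebesgue_cons /pushforward.
rewrite (_ : _ @^-1` _ =
  A ord0 `*` [set t | forall i, A (lift ord0 i) (tnth t i)]); last first.
  apply/seteqP; split => -[a t] /=.
    move=> H; split; first by have := H ord0.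
    by move=> i; have := H (lift ord0 i); rewrite /cons_vec /= tnthS.
  move=> [Ha Ht] i; case: (unliftP ord0 i) => [j ->|->] //.
  by rewrite /cons_vec /= tnthS.
have mB :
    measurable [set t : d.-tuple R | forall i, A (lift ord0 i) (tnth t i)].
  have -> : [set t : d.-tuple R | forall i, A (lift ord0 i) (tnth t i)] =
    \bigcap_(i in [set: 'I_d]) ((@tnth d R ^~ i) @^-1` A (lift ord0 i)).
    by apply/seteqP; split => [t H i _|t H i]; [exact: H|exact: (H i I)].
  apply: fin_bigcap_measurable => // i _.
  by rewrite -[X in measurable X]setTI; exact: measurable_tnth.
rewrite product_measure1E//; last exact: mA.
by congr (_ * _)%E; exact: IH.
Qed.

Section markov.
Context (R : realType) (d : nat) (disp : measure_display)
  (Omega : measurableType disp) (P : probability Omega R).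
Local Notation T := (d.-tuple R).
Local Notation mu := (lebesgue_vec R d).
Implicit Types (X : nat -> {RV P >-> T}) (p : T * T -> R).

Definition kernel_density p : Prop :=
  [/\ measurable_fun setT p, forall z, 0 <= p z &
      forall x, (\int[mu]_y (p (x, y))%:E = 1)%E].

(* The conditional law of X_(i+1) given sigma(X_0, ..., X_i) is s(X_i, y)dy. *)
Definition markov_chain X (s : T * T -> R) : Prop :=
  kernel_density s /\
  forall (i : nat) (G : set Omega) (B : set T),
    g_sigma_preimage (fun j : 'I_i.+1 => X j : Omega -> T) G ->
    measurable B ->
    (P (G `&` X i.+1 @^-1` B) =
     \int[P]_(w in G) \int[mu]_(y in B) (s (X i w, y))%:E)%E.

(* [p (x, _)] is a density of the conditional law of [Z] given [Y = x]. *)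
Definition cond_density (Y Z : {RV P >-> T}) p : Prop :=
  kernel_density p /\
  forall A B : set T, measurable A -> measurable B ->
    (P (Y @^-1` A `&` Z @^-1` B) =
     \int[P]_(w in Y @^-1` A) \int[mu]_(y in B) (p (Y w, y))%:E)%E.

(* (X_k, ..., X_(k+m-1)) has the same law as (X_0, ..., X_(m-1)). *)
Definition stationary X : Prop :=
  forall (k m : nat) (B : set (m.-tuple T)), measurable B ->
    P ((fun w => [tuple X (k + j)%N w | j < m]) @^-1` B) =
    P ((fun w => [tuple X j w | j < m]) @^-1` B).

Definition has_density (Y : {RV P >-> T}) (phi : T -> R) : Prop :=
  [/\ measurable_fun setT phi, forall x, 0 <= phi x &
      forall B, measurable B ->
        distribution P Y B = (\int[mu]_(x in B) (phi x)%:E)%E].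

End markov.

Section deterministic.
Context (R : realType) (d : nat).
Local Notation T := (d.-tuple R).
Local Notation mu := (lebesgue_vec R d).
Local Notation cube := (set (T * T)).
Local Notation partition := (set cube).
Implicit Types (K : cube) (m : partition) (f g : T * T -> R) (phi : T -> R).

Definition unit_cube : cube :=
  [set z | forall i : 'I_d, 0 <= tnth z.1 i <= 1 /\ 0 <= tnth z.2 i <= 1].

Definition beta_coef (sq : T * T -> R) phi : \bar R :=
  (\int[mu \x mu]_z (`|sq z - phi z.2| * phi z.1)%:E)%E.

(* The squared distances are extended-real integrals, hence meaningful without
   side conditions; the distances are finite on the cones of interest. *)
Definition h2 phi f g : \bar R :=
  ((2^-1)%:E * \int[mu \x mu]_(z in unit_cube)
     ((Num.sqrt (f z) - Num.sqrt (g z)) ^+ 2 * phi z.1)%:E)%E.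

Definition h_dist phi f (V : set (T * T -> R)) : \bar R :=
  ereal_inf [set sqrte (h2 phi f g) | g in V].

Definition dyadic_interval (j l : nat) : set R :=
  if (l < 2 ^ j)%N then `[(l%:R - 1) / 2 ^+ j, l%:R / 2 ^+ j[%classic
  else `[(2 ^+ j - 1) / 2 ^+ j, 1]%classic.

Definition dyadic_cubes (j : nat) : set cube :=
  [set K | exists l l' : 'I_d -> nat,
    (forall i, (1 <= l i <= 2 ^ j)%N /\ (1 <= l' i <= 2 ^ j)%N) /\
    K = [set z | forall i, dyadic_interval j (l i) (tnth z.1 i) /\
                           dyadic_interval j (l' i) (tnth z.2 i)]].

Definition subcubes K : set cube :=
  [set K' | exists j, [/\ dyadic_cubes j K, dyadic_cubes j.+1 K' &
                          K' `<=` K]].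

(* [D] is the set of cubes of [m] that are divided. *)
Definition refine m (D : set cube) : partition :=
  (m `\` D) `|` \bigcup_(K in D) subcubes K.

Fixpoint partitions_fin (l : nat) : set partition :=
  if l is l'.+1 then
    partitions_fin l' `|`
    [set m' | exists m D, [/\ partitions_fin l' m, D `<=` m &
                              m' = refine m D]]
  else [set [set unit_cube]].

(* [None] stands for the level oo. *)
Definition partitions (l : option nat) : set partition :=
  if l is Some l then partitions_fin l
  else \bigcup_(l in [set l | (1 <= l)%N]) partitions_fin l.

(* V_m *)
Definition pw_const m : set (T * T -> R) :=
  [set f | exists a : cube -> R, (forall K, 0 <= a K) /\
     f = fun z => \sum_(K \in m) a K * \1_K z].

(* m \vee K *)
Definition join_cube m K : set cube :=
  [set K'' | exists K', [/\ m K', (K `&` K') !=set0 & K'' = K' `&` K]].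

Section data.
Context (n : nat) (L : R) (x : nat -> T).

Definition H2 f g : \bar R :=
  ((2 * n%:R)^-1%:E * \sum_(i < n) \int[mu]_y
     ((Num.sqrt (f (x i, y)) - Num.sqrt (g (x i, y))) ^+ 2)%:E)%E.

Definition H_dist f (V : set (T * T -> R)) : \bar R :=
  ereal_inf [set sqrte (H2 f g) | g in V].

(* [hist m] is \hat s_m; [_ / 0 = 0] gives the convention 0/0 = 0, also used in
   [test_T]. *)
Definition hist m : T * T -> R := fun z =>
  \sum_(K \in m) (\sum_(i < n) \1_K (x i, x i.+1)) /
                 (\sum_(i < n) \int[mu]_y \1_K (x i, y)) * \1_K z.

(* Only applied to finite sets ([fset_set] is empty on infinite ones). *)
Definition pen (S : set cube) : R :=
  L * (#|` fset_set S|%fset)%:R * ln n%:R / n%:R.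

Definition test_T f g : R :=
  (2 * n%:R * Num.sqrt 2)^-1 *
    (\sum_(i < n) \int[mu]_y
       (Num.sqrt (f (x i, y) + g (x i, y)) *
        (Num.sqrt (g (x i, y)) - Num.sqrt (f (x i, y)))))
  + (n%:R * Num.sqrt 2)^-1 *
    (\sum_(i < n)
       (Num.sqrt (g (x i, x i.+1)) - Num.sqrt (f (x i, x i.+1))) /
       Num.sqrt (f (x i, x i.+1) + g (x i, x i.+1)))
  + (2 * n%:R)^-1 *
    (\sum_(i < n) \int[mu]_y (f (x i, y) - g (x i, y))).

Definition alpha : R := (1 - (Num.sqrt 2)^-1) / 2.

Definition restr f K : T * T -> R := fun z => f z * \1_K z.

(* \gamma(m) for the level [l]. *)
Definition contrast (l : option nat) m : \bar R :=
  (\sum_(K \in m)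
     ereal_sup [set \sum_(K' \in m')
         (alpha%:E * H2 (restr (hist m) (K `&` K'))
                        (restr (hist m') (K `&` K'))
          + (test_T (restr (hist m) (K `&` K'))
                    (restr (hist m') (K `&` K')))%:E)
         - (pen (join_cube m' K))%:E | m' in partitions l]
   + (2 * pen m)%:E)%E.

End data.
End deterministic.

Section estimator.
Context (R : realType) (d : nat) (disp : measure_display)
  (Omega : measurableType disp) (P : probability Omega R).
Local Notation T := (d.-tuple R).

(* The events [mhat = m] are required to be measurable, so that the risk of the
   selected estimator is an integral of a random variable. *)
Definition selected (X : nat -> {RV P >-> T}) (n : nat) (L : R)
    (l : option nat) (mhat : Omega -> set (set (T * T))) : Prop :=
  (forall m, partitions l m -> measurable (mhat @^-1` [set m])) /\
  forall w, let gamma := contrast n L (fun i => X i w) l in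
    partitions l (mhat w) /\
    (gamma (mhat w) <= ereal_inf [set gamma m | m in partitions l]
                       + (n%:R^-1)%:E)%E.

Definition s_hat (X : nat -> {RV P >-> T}) (n : nat)
    (mhat : Omega -> set (set (T * T))) (w : Omega) : T * T -> R :=
  hist n (fun i => X i w) (mhat w).

End estimator.

(* The oracle inequality, over all chains, that determines which [L0] are
   admissible; the chain is not assumed stationary here. *)
Definition oracle_constant (R : realType) (L0 : R) : Prop :=
  0 < L0 /\
  exists2 C0 : R, 0 < C0 &
  forall (d n : nat) (disp : measure_display) (Omega : measurableType disp)
    (P : probability Omega R) (X : nat -> {RV P >-> d.-tuple R})
    (s : d.-tuple R * d.-tuple R -> R) (L : R) (l : option nat)
    (mhat : Omega -> set (set (d.-tuple R * d.-tuple R))),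
  (1 <= d)%N -> (3 < n)%N -> markov_chain X s ->
  L0 <= L -> l != Some 0%N -> selected X n L l mhat ->
  let sA := restr s (@unit_cube R d) in
  (C0%:E * \int[P]_w H2 n (fun i => X i w) sA (s_hat X n mhat w) <=
   ereal_inf [set \int[P]_w (H_dist n (fun i => X i w) sA (pw_const m)) ^+ 2
                  + (pen n L m)%:E | m in @partitions R d l])%E.

Definition remainder (R : realType) (d n l : nat) (kappa0 : R)
    (beta : nat -> \bar R) : \bar R :=
  ((n%:R * 2 ^+ (3 * l * d))%:E *
   ereal_inf [set (expR (- (kappa0 / 10 * (n%:R / (q%:R * 2 ^+ (l * d))))))%:E
                  + (n%:R)%:E * beta q * (q%:R^-1)%:E
             | q in [set q | (1 <= q <= n)%N]])%E.

(* Main.v *)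
(** On the event where every dyadic cell [I] of level [l] is visited at least
    [n p / 16] times, [p = P (X_0 \in I)], the empirical distance [H] dominates
    [h] up to a constant between functions that are constant on the cells in
    the first variable, such as the estimator and the elements of [V_m]; the
    oracle inequality for [H] then transfers to [h], because [E H^2 = h^2] for
    fixed functions by stationarity.  Off this event [h^2] is at most
    [2 ^ (l d)].

    To bound the probability of too few visits, the chain is split into its [q]
    subsequences of step [q].  Along one of them the number of visits behaves
    like a binomial variable up to [2 beta_q] per step: the conditional law of
    [X_(t+q)] given the past is within [beta_q] of the stationary one, so
    peeling off the last variable replaces a [0, 1]-valued test function by its
    average, and Chernoff's bound follows by induction.  If the total number of
    visits is small, at least half of the subsequences have few visits, and
    Markov's inequality avoids a union bound over the [q] of them. *)
Require Import Defs.
From mathcomp Require Import all_boot all_order all_algebra finmap.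
From mathcomp Require Import all_classical all_reals all_analysis.
From mathcomp Require Import ring lra zify.
From mathcomp Require Import measurable_realfun.
Set Implicit Arguments.
Unset Strict Implicit.
Unset Printing Implicit Defensive.
Import Order.TTheory GRing.Theory Num.Theory.
Import numFieldNormedType.Exports.
Local Open Scope classical_set_scope.
Local Open Scope ring_scope.

(** * Dyadic cells *)

Section dyadic.
Context (R : realType).

(** The obstacle is that neither comparison applies to the pair of interest: [h] is dominated by [H]
    only between step functions, which [s] is not, while the expectation of [H^2] is [h^2] only for
    deterministic functions, which the estimator is not. A fixed [f] in [V_m] is the intermediary:
    for [h] one goes from [s] to [f] to the estimator, and for [H] from [f] back through [s] to the
    estimator. The two squared triangle inequalities around the comparison give 64 = 2 * 16 * 2,
    then 66 = 2 + 64. The 16 comes from the visits: a quarter of the expected number along a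
    subsequence, half of the subsequences, and a factor 2 lost in rounding [n / q]. No coupling with
    independent variables is built: beta_q enters only through probabilities of events, and the
    dependence on the whole past is reduced to the law of the pair [(X_0, X_q)]. *)

Definition dyadic_idx (j : nat) (t : R) : nat :=
  minn (Num.trunc (t * 2 ^+ j)) (2 ^ j).-1.

Lemma dyadic_idx_lt j (t : R) : (dyadic_idx j t < 2 ^ j)%N.
Proof.
rewrite /dyadic_idx; have := expn_gt0 2 j; case: (2 ^ j)%N => // m _ /=.
by rewrite ltnS geq_minr.
Qed.

(** The cap in [dyadic_idx] sends [t = 1] to the last index, whose interval is closed on the right;
    the predecessor reconciles one-based intervals with zero-based indices. Membership becomes an
    equality between integers. *)
Lemma dyadic_intervalE j a (t : R) : (1 <= a <= 2 ^ j)%N ->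
  dyadic_interval j a t <-> 0 <= t <= 1 /\ dyadic_idx j t = a.-1.
Proof.
case: a => // a /andP[_ aj]; rewrite /dyadic_interval /dyadic_idx /=.
have pj : (0 : R) < 2 ^+ j by rewrite exprn_gt0.
have e2 : ((2 ^ j)%:R : R) = 2 ^+ j by rewrite natrX.
rewrite -natr1 addrK; case: ltnP => [aj'|ja] /=.
- rewrite in_itv /= ler_pdivrMr// ltr_pdivlMr//; split.
    move=> /andP[h1 h2].
    have t0 : 0 <= t by rewrite -(pmulr_lge0 _ pj) (le_trans _ h1).
    split.
      rewrite t0 /= -(ler_pM2r pj) mul1r (le_trans (ltW h2))// -e2.
      by rewrite natr1 ler_nat.
    have -> : Num.trunc (t * 2 ^+ j) = a.
      by apply: truncn_def; rewrite h1 -[a.+1]addn1 natrD.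
    by apply/minn_idPl; rewrite -ltnS prednK// expn_gt0.
  move=> [/andP[t0 t1]] /eqP.
  rewrite /minn; case: ifP => _ /eqP; last first.
    by move=> ea; rewrite -ea prednK ?expn_gt0// ltnn in aj'.
  move=> /eqP; rewrite truncn_eq; first by rewrite -[a.+1]addn1 natrD.
  by rewrite mulr_ge0// ltW.
- have ea : a = (2 ^ j).-1.
    by apply/eqP; rewrite eqn_leq -ltnS prednK ?expn_gt0// aj -ltnS prednK// expn_gt0.
  rewrite -ea in_itv /= ler_pdivrMr// -e2.
  have -> : ((2 ^ j)%:R - 1 : R) = a%:R.
    by rewrite ea -[in LHS](@prednK (2 ^ j)) ?expn_gt0// -natr1 addrK.
  rewrite e2; split.
    move=> /andP[h1 h2].
    have t0 : 0 <= t by rewrite -(pmulr_lge0 _ pj) (le_trans _ h1).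
    rewrite t0 h2; split => //; apply/minn_idPr.
    by rewrite truncn_ge_nat// mulr_ge0// ltW.
  move=> [/andP[t0 t1]] /minn_idPr.
  by rewrite truncn_ge_nat ?t1 ?andbT// mulr_ge0// ltW.
Qed.

(** Halving commutes with truncation, and with the cap since half of 2^(j+1) - 1 is 2^j - 1. *)
Lemma dyadic_idxS j (t : R) : 0 <= t ->
  dyadic_idx j t = (dyadic_idx j.+1 t)./2.
Proof.
move=> t0; rewrite /dyadic_idx.
have th : Num.trunc (t * 2 ^+ j) = (Num.trunc (t * 2 ^+ j.+1))./2.
  have u0 : 0 <= t * 2 ^+ j by rewrite mulr_ge0// exprn_ge0.
  apply: truncn_def; rewrite exprSr mulrA.
  have v0 : 0 <= t * 2 ^+ j * 2 by rewrite mulr_ge0.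
  have /andP[h1 h2] := truncn_itv v0.
  set k := Num.trunc _ in h1 h2 *; apply/andP; split.
    rewrite -(@ler_pM2r _ 2)// (le_trans _ h1)// -natrM ler_nat.
    by rewrite muln2 -[leqRHS]odd_double_half leq_addl.
  rewrite -(@ltr_pM2r _ 2)// (lt_le_trans h2)// -natrM ler_nat.
  by rewrite muln2; lia.
rewrite th expnS; have : (0 < 2 ^ j)%N by rewrite expn_gt0.
by move: (Num.trunc _) (2 ^ j)%N => k m m0; lia.
Qed.

Lemma dyadic_idx_refine j l (t t' : R) : (j <= l)%N -> 0 <= t -> 0 <= t' ->
  dyadic_idx l t = dyadic_idx l t' -> dyadic_idx j t = dyadic_idx j t'.
Proof.
move=> jl t0 t'0; rewrite -(subnK jl); elim: (l - j)%N => // k IH.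
rewrite addSn => e; apply: IH.
by rewrite dyadic_idxS// e -dyadic_idxS.
Qed.

End dyadic.

Section cells.
Context (R : realType) (d : nat).
Local Notation T := (d.-tuple R).
Local Notation mu := (lebesgue_vec R d).

(** Cells live in R^d: a dyadic cube of R^(2d) is a product of two of them, and the visits of the
    chain concern the first factor. *)
Definition cell (j : nat) (c : {ffun 'I_d -> 'I_(2 ^ j)}) : set T :=
  [set x | forall i, 0 <= tnth x i <= 1 /\ dyadic_idx j (tnth x i) = c i].

Lemma cell_box j (c : {ffun 'I_d -> 'I_(2 ^ j)}) :
  cell c = [set x | forall i, dyadic_interval j (c i).+1 (tnth x i)].
Proof.
apply/seteqP; split => x /= h i.
  by apply/dyadic_intervalE; [rewrite ltn_ord|exact: h].
by have /dyadic_intervalE : dyadic_interval j (c i).+1 (tnth x i) by [];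
  apply; rewrite ltn_ord.
Qed.

Lemma measurable_dyadic_interval j a :
  measurable (@dyadic_interval R j a).
Proof. by rewrite /dyadic_interval; case: ifP. Qed.

Lemma measurable_cell j (c : {ffun 'I_d -> 'I_(2 ^ j)}) : measurable (cell c).
Proof.
rewrite cell_box.
have -> : [set x : T | forall i, dyadic_interval j (c i).+1 (tnth x i)] =
    \bigcap_(i in [set: 'I_d]) ((@tnth d R ^~ i) @^-1` dyadic_interval j (c i).+1).
  by apply/seteqP; split => [t H i _|t H i]; [exact: H|exact: (H i I)].
apply: fin_bigcap_measurable => // i _.
rewrite -[X in measurable X]setTI; apply: measurable_tnth => //.
exact: measurable_dyadic_interval.
Qed.

Lemma lebesgue_dyadic_interval j a : (0 < a <= 2 ^ j)%N ->
  @lebesgue_measure R (dyadic_interval j a) = ((2 ^+ j)^-1)%:E.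
Proof.
move=> /andP[a0 aj]; rewrite /dyadic_interval.
have pj : (0 : R) < 2 ^+ j by rewrite exprn_gt0.
case: ifP => _; rewrite lebesgue_measure_itv /= lte_fin.
  rewrite ltr_pM2r ?invr_gt0// ltrBlDr ltrDl ltr01 -EFinB.
  by rewrite -mulrBl opprB addrC subrK mul1r.
rewrite ltr_pdivrMr// mul1r ltrBlDr ltrDl ltr01 -EFinB.
by rewrite mulrBl divff ?gt_eqF// opprB addrC subrK mul1r.
Qed.

Lemma lebesgue_cell j (c : {ffun 'I_d -> 'I_(2 ^ j)}) :
  mu (cell c) = ((2 ^+ (j * d))^-1)%:E.
Proof.
rewrite cell_box (lebesgue_vec_box (A := fun i => dyadic_interval j (c i).+1)); last first.
  by move=> i; exact: measurable_dyadic_interval.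
under eq_bigr do rewrite lebesgue_dyadic_interval ?ltn_ord//.
by rewrite prodEFin prodr_const card_ord exprVn exprM.
Qed.

Lemma cell_ex j (x : T) : (forall i, 0 <= tnth x i <= 1) ->
  exists c, @cell j c x.
Proof.
move=> x01; exists [ffun i => Ordinal (dyadic_idx_lt j (tnth x i))] => i.
by rewrite ffunE.
Qed.

Lemma cell_inj j (c c' : {ffun 'I_d -> 'I_(2 ^ j)}) x :
  cell c x -> cell c' x -> c = c'.
Proof.
move=> h h'; apply/ffunP => i; apply/val_inj => /=.
by have [_ <-] := h i; have [_ <-] := h' i.
Qed.

Lemma cell_refine j l (b : {ffun 'I_d -> 'I_(2 ^ l)})
    (a : {ffun 'I_d -> 'I_(2 ^ j)}) x x' : (j <= l)%N ->
  cell b x -> cell b x' -> cell a x -> cell a x'.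
Proof.
move=> jl h h' k i; have [/andP[x0 _] ex] := h i.
have [x'01 ex'] := h' i; split => //; have [_ <-] := k i.
apply: (dyadic_idx_refine jl) => //; last by rewrite ex ex'.
by case/andP: x'01.
Qed.

Lemma dyadic_cubesP j (K : set (T * T)) :
  dyadic_cubes j K <-> exists c c', K = @cell j c `*` @cell j c'.
Proof.
split.
  move=> [a [a' [ha ->]]].
  have lt1 i : ((a i).-1 < 2 ^ j)%N.
    by have [/andP[h1 h2] _] := ha i; rewrite prednK.
  have lt2 i : ((a' i).-1 < 2 ^ j)%N.
    by have [_ /andP[h1 h2]] := ha i; rewrite prednK.
  exists [ffun i => Ordinal (lt1 i)], [ffun i => Ordinal (lt2 i)].
  rewrite !cell_box; apply/seteqP; split => -[x y] /=.
    move=> h; split => i; rewrite ffunE /= prednK; have [h1 h2] := ha i;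
      by have [] := h i; move: h1 h2 => /andP[? ?] /andP[].
  move=> [h h'] i; move: (h i) (h' i); rewrite !ffunE /= !prednK //.
    by have [_ /andP[]] := ha i.
  by have [/andP[]] := ha i.
move=> [c [c' ->]].
exists (fun i => (c i).+1), (fun i => (c' i).+1); split.
  by move=> i; rewrite !ltn_ord.
rewrite !cell_box; apply/seteqP; split => -[x y] /=; first by case.
by move=> h; split => i; have [] := h i.
Qed.

Lemma lebesgue_cell_prod j (c c' : {ffun 'I_d -> 'I_(2 ^ j)}) :
  (mu \x mu)%E (cell c `*` cell c') = ((2 ^+ (2 * (j * d)))^-1)%:E.
Proof.
rewrite product_measure1E; try exact: measurable_cell.
rewrite mul2n -addnn exprD invfM EFinM.
by congr (_ * _)%E; exact: lebesgue_cell.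
Qed.

(** The volume 2^(-2jd) of a cube determines its level once [d] is positive. *)
Lemma dyadic_cubes_level j j' (K : set (T * T)) : (1 <= d)%N ->
  dyadic_cubes j K -> dyadic_cubes j' K -> j = j'.
Proof.
move=> d1 /dyadic_cubesP[c [c' ->]] /dyadic_cubesP[b [b' e]].
have : (mu \x mu)%E (cell c `*` cell c') = (mu \x mu)%E (cell b `*` cell b').
  by rewrite e.
rewrite !lebesgue_cell_prod => -[] /eqP.
rewrite (inj_eq invr_inj) -!natrX eqr_nat eqn_exp2l//.
by rewrite eqn_pmul2l// eqn_pmul2r// => /eqP.
Qed.

Lemma dyadic_cubes_disjoint j (K K' : set (T * T)) z :
  dyadic_cubes j K -> dyadic_cubes j K' -> K z -> K' z -> K = K'.
Proof.
move=> /dyadic_cubesP[c [c' ->]] /dyadic_cubesP[b [b' ->]] [h1 h2] [h3 h4].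
by rewrite (cell_inj h1 h3) (cell_inj h2 h4).
Qed.

Lemma finite_dyadic_cubes j : finite_set (@dyadic_cubes R d j).
Proof.
apply: (@sub_finite_set _ _
  ((fun c => @cell j c.1 `*` @cell j c.2) @` [set: {ffun 'I_d -> 'I_(2 ^ j)} * {ffun 'I_d -> 'I_(2 ^ j)}])).
  by move=> K /dyadic_cubesP[c [c' ->]]; exists (c, c').
exact: finite_image.
Qed.

Lemma dyadic_cubes_unit : dyadic_cubes 0 (@unit_cube R d).
Proof.
apply/dyadic_cubesP; exists [ffun=> ord0], [ffun=> ord0].
have i0 (t : R) : dyadic_idx 0 t = 0%N by rewrite /dyadic_idx minn0.
apply/seteqP; split => -[x y] /=.
  by move=> h; split => i; rewrite ffunE i0; have [] := h i.
by move=> [h h'] i; have [] := h i; have [] := h' i.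
Qed.

Lemma dyadic_cubes_sub_unit j (K : set (T * T)) :
  dyadic_cubes j K -> K `<=` @unit_cube R d.
Proof.
move=> /dyadic_cubesP[c [c' ->]] [x y] [h h'] i.
by have [] := h i; have [] := h' i.
Qed.

(** Two subcubes that meet have parents that meet, hence equal parents; uniqueness of the level then
    puts them in the same grid, whose cubes are disjoint. A subcube cannot meet an undivided cube,
    which would have to equal its parent. *)
Lemma partitions_finP l (m : set (set (T * T))) : (1 <= d)%N ->
  partitions_fin l m ->
  (forall K, m K -> exists2 j, (j <= l)%N & dyadic_cubes j K) /\
  (forall K K' z, m K -> m K' -> K z -> K' z -> K = K').
Proof.
move=> d1; elim: l m => [|l IH] m /=.
  move=> ->; split; first by move=> K ->; exists 0%N => //; exact: dyadic_cubes_unit.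
  by move=> K K' z -> ->.
case=> [/IH[h1 h2]|[m' [D [/IH[h1 h2] Dm ->]]]].
  by split => // K /h1[j jl Kj]; exists j => //; rewrite (leq_trans jl).
split.
  move=> K [[/h1[j jl Kj] _]|[K1 D1 [j [Kj K'j _]]]].
    by exists j => //; rewrite (leq_trans jl).
  have [j' j'l K1j'] := h1 _ (Dm _ D1).
  by exists j.+1 => //; rewrite (dyadic_cubes_level d1 Kj K1j').
move=> K K' z.
case=> [[mK DK]|[K1 D1 [j [Kj K1j K1s]]]] [[mK' DK']|[K2 D2 [k [Kk K2k K2s]]]] Kz K'z.
- exact: (h2 _ _ z).
- by case: DK; rewrite (h2 _ _ z mK (Dm _ D2) Kz (K2s _ K'z)).
- by case: DK'; rewrite (h2 _ _ z mK' (Dm _ D1) K'z (K1s _ Kz)).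
- have e := h2 _ _ z (Dm _ D1) (Dm _ D2) (K1s _ Kz) (K2s _ K'z).
  rewrite -e in Kk; have ejk := dyadic_cubes_level d1 Kj Kk; rewrite -ejk in K2k.
  exact: (dyadic_cubes_disjoint K1j K2k Kz K'z).
Qed.

Definition cubes_upto l : set (set (T * T)) :=
  \bigcup_(j in `I_l.+1) @dyadic_cubes R d j.

Lemma finite_cubes_upto l : finite_set (cubes_upto l).
Proof. by apply: bigcup_finite => // j _; exact: finite_dyadic_cubes. Qed.

Lemma partitions_fin_sub l (m : set (set (T * T))) : (1 <= d)%N ->
  partitions_fin l m -> m `<=` cubes_upto l.
Proof.
by move=> d1 /(partitions_finP d1)[h _] K /h[j jl Kj]; exists j.
Qed.

Lemma partition_finite l (m : set (set (T * T))) : (1 <= d)%N ->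
  partitions_fin l m -> finite_set m.
Proof.
by move=> d1 /(partitions_fin_sub d1) h; exact: sub_finite_set h (finite_cubes_upto l).
Qed.

(** A partition is a subset of the finite set of cubes of level at most [l]. This makes the
    selection of [mhat] a finite choice, whence the measurability of the loss. *)
Lemma finite_partitions l : (1 <= d)%N -> finite_set (@partitions_fin R d l).
Proof.
move=> d1; pose A := fset_set (cubes_upto l).
apply: (@sub_finite_set _ _
  ((fun B : {fset set (T * T)} => [set` B]) @` [set` fpowerset A])); last first.
  exact/finite_image/finite_fset.
move=> m hm; have ms := partitions_fin_sub d1 hm.
exists [fset K in A | K \in m]%fset => /=.
  by rewrite fpowersetE; apply/fsubsetP => K; rewrite !inE => /andP[].
apply/seteqP; split => K /=; rewrite !inE /=; first by case/andP => _ /set_mem.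
move=> mK; rewrite in_fset_set; last exact: finite_cubes_upto.
by rewrite !mem_set//; exact: ms.
Qed.

End cells.

(** * Integration *)

Section integration.
Local Open Scope ereal_scope.
Context (disp : measure_display) (T : measurableType disp) (R : realType).

(* The library's [ge0_le_integral] asks for measurability. *)
Lemma ge0_le_integral_nonmeas (mu : {measure set T -> \bar R}) (f g : T -> \bar R) :
  (forall x, 0 <= f x) -> (forall x, f x <= g x) ->
  \int[mu]_x f x <= \int[mu]_x g x.
Proof.
move=> f0 fg; have g0 x : 0 <= g x by rewrite (le_trans (f0 x)).
rewrite !ge0_integralTE//; apply: ereal_sup_le => _ [h hf <-].
by exists h => // x; rewrite (le_trans (hf x)).
Qed.

Import HBNNSimple.

(** Monotone convergence along simple functions reduces the claim to indicators. It serves for the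
    law of [X t], for restricted measures and for the law of [X t.+1] on an event of the past. *)
Lemma ge0_integral_density (nu la : {measure set T -> \bar R})
    (k g : T -> \bar R) :
  measurable_fun setT k -> (forall x, 0 <= k x) ->
  (forall B, measurable B -> nu B = \int[la]_(x in B) k x) ->
  measurable_fun setT g -> (forall x, 0 <= g x) ->
  \int[nu]_x g x = \int[la]_x (g x * k x).
Proof.
move=> mk k0 nuE mg g0.
pose h := nnsfun_approx measurableT mg.
have hg x : (EFin \o h^~ x) n @[n --> \oo] --> g x by exact: cvg_nnsfun_approx.
have nd x a b : (a <= b)%N -> (h a x <= h b x)%R.
  by move=> ab; have /lefP := @nd_nnsfun_approx _ _ _ _ measurableT _ mg a b ab; exact.
have mh n : measurable_fun setT (EFin \o h n) by exact/measurable_EFinP.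
have h0 n x : 0 <= (h n x)%:E by rewrite lee_fin.
have -> : \int[nu]_x g x = limn (fun n => \int[nu]_x (h n x)%:E).
  rewrite -monotone_convergence//.
  - by apply: eq_integral => x _; apply/esym/cvg_lim => //; exact: hg.
  - by move=> x _ a b ab; rewrite lee_fin nd.
have -> : \int[la]_x (g x * k x) = limn (fun n => \int[la]_x ((h n x)%:E * k x)).
  rewrite -monotone_convergence//.
  - apply: eq_integral => x _; apply/esym/cvg_lim => //.
    (* The product of the limits is indeterminate when one factor is 0 and the other infinite; in
       both zero cases the sequence is constantly 0. *)
    have [gx0|gx0] := eqVneq (g x) 0.
      have hn0 n : (h n x)%:E = 0.
        apply/eqP; rewrite eq_le h0 andbT -gx0.
        rewrite (cvg_unique _ (hg x) (ereal_nondecreasing_cvgn _))//.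
          by apply: ereal_sup_ubound; exists n.
        by move=> a b ab; rewrite lee_fin nd.
      rewrite gx0 mul0e [X in X @ _ --> _](_ : _ = cst 0); first exact: cvg_cst.
      by apply/funext => n; rewrite hn0 mul0e.
    have [kx0|kx0] := eqVneq (k x) 0.
      rewrite kx0 mule0 [X in X @ _ --> _](_ : _ = cst 0); first exact: cvg_cst.
      by apply/funext => n; rewrite mule0.
    apply: cvgeM; [|exact: hg|exact: cvg_cst].
    by rewrite mule_defE (negbTE gx0) (negbTE kx0).
  - by move=> n; exact: (emeasurable_funM (mh n) mk).
  - by move=> n x _; rewrite mule_ge0.
  - by move=> x _ a b ab; rewrite lee_wpmul2r// lee_fin nd.
congr (limn _); apply/funext => n.
have mi r : measurable (h n @^-1` [set r]) by exact: measurable_funPTI.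
have hi r x : 0 <= (r * \1_(h n @^-1` [set r]) x)%:E by exact: nnfun_muleindic_ge0.
have mi' r : measurable_fun setT (fun x => (r * \1_(h n @^-1` [set r]) x)%:E).
  by apply/measurable_EFinP; exact: measurable_funM.
have hE x : (h n x)%:E = \sum_(r \in range (h n)) (r * \1_(h n @^-1` [set r]) x)%:E.
  by rewrite [in LHS]fimfunE -fsumEFin.
under eq_integral do rewrite hE.
under [RHS]eq_integral do rewrite hE ge0_mule_fsuml//.
rewrite !ge0_integral_fsum//; last 2 first.
- by move=> r; exact: emeasurable_funM.
- by move=> r x _; rewrite mule_ge0.
apply: eq_fsbigr => r; rewrite inE => -[x _ hr].
have r0 : (0 <= r)%R by rewrite -hr.
under eq_integral do rewrite EFinM.
under [RHS]eq_integral do rewrite EFinM -muleA.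
have mI : measurable_fun setT (fun y => (\1_(h n @^-1` [set r]) y : R)%:E).
  by apply/measurable_EFinP; exact: measurable_indic.
rewrite !ge0_integralZl//; last 2 first.
- exact: (emeasurable_funM mI mk).
- by move=> y _; rewrite mule_ge0// lee_fin.
congr (_ * _); rewrite integral_indic// setIT nuE// integral_mkcond.
apply: eq_integral => y _; rewrite epatch_indic muleC//.
Qed.

End integration.

(** * Stationary Markov chains *)

Section indicators.
Local Open Scope ereal_scope.
Context (disp : measure_display) (T : measurableType disp) (R : realType).

Lemma integral_mkindic (mu : {measure set T -> \bar R}) (D : set T) (f : T -> \bar R) :
  \int[mu]_(x in D) f x = \int[mu]_x (f x * (\1_D x)%:E).
Proof. by rewrite integral_mkcond epatch_indic. Qed.

Lemma measurable_EFin_indic (D : set T) : measurable D ->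
  measurable_fun setT (fun x : T => (\1_D x : R)%:E).
Proof. by move=> mD; apply/measurable_EFinP; exact: measurable_indic. Qed.

Lemma ge0_integral_mrestr (mu : {measure set T -> \bar R}) (D : set T)
    (mD : measurable D) (f : T -> \bar R) :
  measurable_fun setT f -> (forall x, 0 <= f x) ->
  \int[mrestr mu mD]_x f x = \int[mu]_(x in D) f x.
Proof.
move=> mf f0; rewrite integral_mkindic; apply: ge0_integral_density => //.
- exact: measurable_EFin_indic.
- by move=> B mB; rewrite integral_indic// setIC.
Qed.

End indicators.

(** * The filtration generated by the chain *)

Section past.
Context (disp disp' : measure_display) (Omega : measurableType disp)
  (T : measurableType disp') (X : nat -> {mfun Omega >-> T}).

Definition past (t : nat) : set (set Omega) :=
  g_sigma_preimage (fun j : 'I_t.+1 => X j : Omega -> T).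

Lemma past_preimage t j A : (j <= t)%N -> measurable A -> past t (X j @^-1` A).
Proof.
move=> jt mA; apply: sub_sigma_algebra; rewrite -bigcup_mkord_ord.
exists (Ordinal (jt : (j < t.+1)%N)) => //.
by rewrite inordK//; exists A => //; rewrite setTI.
Qed.

Lemma past_sub t (H : set (set Omega)) : sigma_algebra setT H ->
  (forall j A, (j <= t)%N -> measurable A -> H (X j @^-1` A)) -> past t `<=` H.
Proof.
move=> sH hH; apply: smallest_sub => // G.
rewrite -bigcup_mkord_ord => -[j jt [A mA <-]].
by rewrite setTI inordK//; exact: hH.
Qed.

Lemma past_mono t t' : (t <= t')%N -> past t `<=` past t'.
Proof.
move=> tt'; apply: past_sub; first exact: smallest_sigma_algebra.
by move=> j A jt mA; apply: past_preimage => //; exact: leq_trans tt'.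
Qed.

Lemma past_measurable t : past t `<=` measurable.
Proof.
apply: past_sub; first exact: sigma_algebra_measurable.
by move=> j A _ mA; exact: measurable_funPTI.
Qed.

Lemma past_setC t G : past t G -> past t (~` G).
Proof. exact: sigma_algebraC. Qed.

Lemma past_setU t G G' : past t G -> past t G' -> past t (G `|` G').
Proof.
move=> pG pG'; rewrite -bigcup2E; apply: sigma_algebra_bigcup.
by move=> [|[|k]] //=; exact: sigma_algebra0.
Qed.

Lemma past_setI t G G' : past t G -> past t G' -> past t (G `&` G').
Proof.
move=> pG pG'; rewrite -(setCK G) -(setCK G') -setCU.
by apply: past_setC; apply: past_setU; exact: past_setC.
Qed.

End past.

Section stationary_chain.
Context (R : realType) (d : nat) (disp : measure_display)
  (Omega : measurableType disp) (P : probability Omega R).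
Local Notation T := (d.-tuple R).
Local Notation mu := (lebesgue_vec R d).
Variables (X : nat -> {RV P >-> T}) (s : T * T -> R) (phi : T -> R).
Hypothesis (sX : stationary X) (phiX : has_density (X 0%N) phi).

Let mphi : measurable_fun setT phi. Proof. by case: phiX. Qed.
Let phi0 x : (0 <= phi x)%R. Proof. by case: phiX. Qed.

Lemma stationary_pair t q A B : measurable A -> measurable B ->
  P (X t @^-1` A `&` X (t + q)%N @^-1` B) = P (X 0%N @^-1` A `&` X q @^-1` B).
Proof.
move=> mA mB.
(* Stationarity speaks of tuples of consecutive variables; the pair is read off the first and last
   of [q.+1] of them. *)
pose D := [set u : q.+1.-tuple T | A (tnth u ord0) /\ B (tnth u ord_max)].
have mD : measurable D.
  rewrite (_ : D = (fun u => tnth u ord0) @^-1` A `&` (fun u => tnth u ord_max) @^-1` B)//.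
  by apply: measurableI; rewrite -[X in measurable X]setTI;
    apply: measurable_tnth.
have := sX t mD.
rewrite (_ : _ @^-1` D = X t @^-1` A `&` X (t + q)%N @^-1` B); last first.
  by apply/seteqP; split => w /=; rewrite /D /= !tnth_mktuple /= addn0.
by rewrite (_ : _ @^-1` D = X 0%N @^-1` A `&` X q @^-1` B)//;
  apply/seteqP; split => w /=; rewrite /D /= !tnth_mktuple.
Qed.

Lemma stationary_marginal t A : measurable A ->
  P (X t @^-1` A) = P (X 0%N @^-1` A).
Proof.
move=> mA; have := stationary_pair t 0 mA measurableT.
by rewrite !preimage_setT !setIT.
Qed.

Lemma stationary_expectation t (g : T -> \bar R) :
  measurable_fun setT g -> (forall x, 0 <= g x)%E ->
  (\int[P]_w g (X t w) = \int[mu]_x (g x * (phi x)%:E))%E.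
Proof.
move=> mg g0.
rewrite -(ge0_integral_density (nu := distribution P (X t)) _ _ _ mg g0).
- by rewrite ge0_integral_pushforward.
- exact/measurable_EFinP.
- by move=> x; rewrite lee_fin.
- by move=> B mB; case: phiX => _ _ /(_ B mB) <-; exact: stationary_marginal.
Qed.

Lemma stationary_prob t A : measurable A ->
  P (X t @^-1` A) = (\int[mu]_(x in A) (phi x)%:E)%E.
Proof.
by move=> mA; rewrite stationary_marginal//; case: phiX => _ _ /(_ _ mA) <-.
Qed.

(** The inequality p(x, y) <= phi(y) + |p(x, y) - phi(y)| is integrated in y over [B], then in x
    over [A] against phi; on the error term both restrictions are dropped, which leaves beta. *)
Lemma cond_density_pair q (p : T * T -> R) A B : cond_density (X 0%N) (X q) p ->
  measurable A -> measurable B ->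
  (P (X 0%N @^-1` A `&` X q @^-1` B) <=
   P (X 0%N @^-1` A) * P (X 0%N @^-1` B) + beta_coef p phi)%E.
Proof.
move=> [[mp p0 _] hp] mA mB; rewrite hp//.
pose f1 (z : T * T) := ((p z)%:E * (\1_B z.2)%:E)%E.
pose f2 (z : T * T) := ((phi z.2)%:E * (\1_B z.2)%:E)%E.
pose f3 (z : T * T) := (`|p z - phi z.2|)%:E.
have m2 (k : T -> R) : measurable_fun setT k -> measurable_fun setT (fun z : T * T => k z.2).
  by move=> mk; apply: measurableT_comp.
have m1 (k : T -> R) : measurable_fun setT k -> measurable_fun setT (fun z : T * T => k z.1).
  by move=> mk; apply: measurableT_comp.
have mf1 : measurable_fun setT f1.
  apply: emeasurable_funM; apply/measurable_EFinP => //.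
  by apply: m2; exact: measurable_indic.
have mf2 : measurable_fun setT f2.
  apply: emeasurable_funM; apply/measurable_EFinP.
    exact: (m2 _ mphi).
  by apply: m2; exact: measurable_indic.
have mf3 : measurable_fun setT f3.
  apply/measurable_EFinP; apply: measurableT_comp => //.
  by apply: measurable_funB => //; exact: m2.
have f10 z : (0 <= f1 z)%E by rewrite mule_ge0// lee_fin.
have f20 z : (0 <= f2 z)%E by rewrite mule_ge0// lee_fin.
have f30 z : (0 <= f3 z)%E by rewrite lee_fin.
have mF (f : T * T -> \bar R) (mf : measurable_fun setT f) (f0 : forall z, (0 <= f z)%E) :
    measurable_fun setT (fun x => \int[mu]_y f (x, y))%E.
  exact: measurable_fun_fubini_tonelli_F.
have intf1 x : (\int[mu]_(y in B) (p (x, y))%:E = \int[mu]_y f1 (x, y))%E.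
  by rewrite integral_mkindic.
pose g1 x := ((\int[mu]_y f1 (x, y)) * (\1_A x)%:E)%E.
have -> : (\int[P]_(w in X 0%N @^-1` A) \int[mu]_(y in B) (p (X 0%N w, y))%:E =
    \int[P]_w g1 (X 0%N w))%E.
  rewrite integral_mkindic; apply: eq_integral => w _ /=.
  by rewrite intf1.
rewrite stationary_expectation; last 2 first.
- by apply: emeasurable_funM; [exact: mF|exact: measurable_EFin_indic].
- by move=> x; rewrite mule_ge0 ?integral_ge0// lee_fin.
have -> : beta_coef p phi = (\int[mu]_x ((\int[mu]_y f3 (x, y)) * (phi x)%:E))%E.
  rewrite /beta_coef fubini_tonelli1.
  - apply: eq_integral => x _; rewrite /fubini_F /=.
    rewrite muleC -ge0_integralZl_EFin//; last first.
      exact: (measurableT_comp mf3 (pair1_measurable x)).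
    by apply: eq_integral => y _; rewrite EFinM muleC.
  - apply/measurable_EFinP; apply: measurable_funM; last exact: m1.
    exact/measurable_EFinP.
  - by move=> z; rewrite lee_fin mulr_ge0.
have pA C : measurable C -> P (X 0%N @^-1` C) = (\int[mu]_x ((\1_C x)%:E * (phi x)%:E))%E.
  move=> mC; rewrite (stationary_prob 0 mC) integral_mkindic.
  by apply: eq_integral => x _; rewrite muleC.
set c := P (X 0%N @^-1` B).
have cE x : c = (\int[mu]_y f2 (x, y))%E.
  by rewrite /c pA//; apply: eq_integral => y _; rewrite /f2 /= muleC.
have mA1 : measurable_fun setT (fun x : T => (\1_A x)%:E * (phi x)%:E)%E.
  by apply: emeasurable_funM; [exact: measurable_EFin_indic|exact/measurable_EFinP].
have A10 x : (0 <= (\1_A x)%:E * (phi x)%:E)%E by rewrite mule_ge0// lee_fin.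
have m3 : measurable_fun setT (fun x : T => (\int[mu]_y f3 (x, y)) * (phi x)%:E)%E.
  by apply: emeasurable_funM; [exact: mF|exact/measurable_EFinP].
rewrite pA// -ge0_integralZr//; last by rewrite /c.
rewrite -ge0_integralD//; last 3 first.
- by move=> x _; rewrite mule_ge0// /c.
- by apply: emeasurable_funM.
- by move=> x _; rewrite mule_ge0 ?integral_ge0// lee_fin.
apply: ge0_le_integral_nonmeas => x.
  by rewrite mule_ge0 ?lee_fin// /g1 mule_ge0 ?integral_ge0// lee_fin.
rewrite /g1 -muleA.
have I1 : (\int[mu]_y f1 (x, y) <= c + \int[mu]_y f3 (x, y))%E.
  rewrite (cE x) -ge0_integralD//; last 2 first.
  - exact: (measurableT_comp mf2 (pair1_measurable x)).
  - exact: (measurableT_comp mf3 (pair1_measurable x)).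
  apply: ge0_le_integral_nonmeas => // y.
  rewrite /f1 /f2 /f3 /= -!EFinM -EFinD lee_fin indicE.
  case: (y \in B); rewrite ?mulr1 ?mulr0 ?add0r//.
  by rewrite -lerBlDl ler_norm.
apply: (le_trans (lee_wpmul2r (A10 x) I1)).
rewrite ge0_muleDl ?integral_ge0 /c// leeD//; first by rewrite muleC.
apply: lee_wpmul2l; first exact: integral_ge0.
rewrite -EFinM lee_fin indicE; case: (x \in A); rewrite ?mul1r ?mul0r//.
Qed.

End stationary_chain.

Lemma fine_prob_split (R : realType) (disp : measure_display)
    (Omega : measurableType disp) (P : probability Omega R) (C D : set Omega) :
  measurable C -> measurable D ->
  fine (P C) = fine (P (C `&` D)) + fine (P (C `&` ~` D)).
Proof.
move=> mC mD; have mCD := measurableI _ _ mC mD.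
have mCD' := measurableI _ _ mC (measurableC mD).
rewrite -fineD ?fin_num_measure//; congr fine.
rewrite -measureU// -?setIUr ?setUv ?setIT//.
by rewrite setIACA setICr setI0.
Qed.

(** * Mixing with respect to the whole past *)

Section markov_mixing.
Context (R : realType) (d : nat) (disp : measure_display)
  (Omega : measurableType disp) (P : probability Omega R).
Local Notation T := (d.-tuple R).
Local Notation mu := (lebesgue_vec R d).
Variables (X : nat -> {RV P >-> T}) (s : T * T -> R) (phi : T -> R).
Hypothesis mX : markov_chain X s.
Local Notation past := (past X).

Let ms : measurable_fun setT s. Proof. by case: mX => -[]. Qed.
Let s0 z : 0 <= s z. Proof. by case: mX => -[]. Qed.
Let s1 x : (\int[mu]_y (s (x, y))%:E = 1)%E. Proof. by case: mX => -[]. Qed.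

(** The Markov property is given for events on [X t.+1]. It says that on [G] this variable has
    density [k y], the integral over [G] of s(X_t, y); integrating [g] against [k] and exchanging
    the integrals gives the claim. *)
Lemma markov_expectation t G (g : T -> \bar R) : past t G ->
  measurable_fun setT g -> (forall x, 0 <= g x)%E ->
  (\int[P]_(w in G) g (X t.+1 w) =
   \int[P]_(w in G) \int[mu]_y (g y * (s (X t w, y))%:E))%E.
Proof.
move=> pG mg g0; have mG := past_measurable pG.
pose f (z : Omega * T) := ((s (X t z.1, z.2))%:E * (\1_G z.1)%:E)%E.
have f0 z : (0 <= f z)%E by rewrite mule_ge0// lee_fin.
have mf : measurable_fun setT f.
  apply: emeasurable_funM; apply/measurable_EFinP.
    apply: (measurableT_comp ms); apply: measurable_fun_pair => //.
    exact: measurableT_comp.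
  by apply: (measurableT_comp (measurable_indic _)).
pose k (y : T) := (\int[P]_w f (w, y))%E.
have mk : measurable_fun setT k by exact: measurable_fun_fubini_tonelli_G.
have k0 y : (0 <= k y)%E by exact: integral_ge0.
have mXt : measurable_fun setT (X t.+1 : Omega -> T) by exact: measurable_funPT.
pose nu : {measure set T -> \bar R} :=
  measure_function_pushforward__canonical__measure_function_Measure (mrestr P mG) mXt.
have nuE B : measurable B -> nu B = (\int[mu]_(y in B) k y)%E.
  move=> mB; rewrite /nu /= /pushforward /mrestr setIC.
  case: mX => _ /(_ t G B pG mB) ->.
  rewrite integral_mkindic [RHS]integral_mkindic.
  pose fB (z : Omega * T) := (f z * (\1_B z.2)%:E)%E.
  have fB0 z : (0 <= fB z)%E by rewrite mule_ge0// lee_fin.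
  have mfB : measurable_fun setT fB.
    apply: emeasurable_funM => //; apply/measurable_EFinP.
    by apply: (measurableT_comp (measurable_indic _)).
  transitivity (\int[P]_w \int[mu]_y fB (w, y))%E.
    apply: eq_integral => w _; rewrite integral_mkindic muleC.
    rewrite -ge0_integralZl_EFin//.
    - by apply: eq_integral => y _; rewrite /fB /f /= muleA [(_ * (s _)%:E)%E]muleC.
    - by move=> y _; rewrite mule_ge0// lee_fin.
    - apply: emeasurable_funM; last exact: measurable_EFin_indic.
      by apply/measurable_EFinP; apply: (measurableT_comp ms).
  rewrite fubini_tonelli//; apply: eq_integral => y _.
  rewrite muleC -ge0_integralZl_EFin//; last first.
    exact: (measurableT_comp mf (pair2_measurable y)).
  by apply: eq_integral => w _; rewrite /fB muleC.
transitivity (\int[nu]_y g y)%E.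
  by rewrite ge0_integral_pushforward//= ge0_integral_mrestr//; exact: measurableT_comp.
transitivity (\int[mu]_y (g y * k y))%E; first exact: (ge0_integral_density mk k0 nuE mg g0).
rewrite [RHS]integral_mkindic.
pose fg (z : Omega * T) := (g z.2 * f z)%E.
have fg0 z : (0 <= fg z)%E by rewrite mule_ge0.
have mfg : measurable_fun setT fg.
  by apply: emeasurable_funM => //; apply: measurableT_comp.
transitivity (\int[mu]_y \int[P]_w fg (w, y))%E.
  apply: eq_integral => y _; rewrite -ge0_integralZl//.
  exact: (measurableT_comp mf (pair2_measurable y)).
rewrite -fubini_tonelli//; apply: eq_integral => w _.
rewrite muleC -ge0_integralZl_EFin//.
- by apply: eq_integral => y _; rewrite /fg /f /= muleA muleC.
- by move=> y _; rewrite mule_ge0// lee_fin.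
- apply: emeasurable_funM => //.
  by apply/measurable_EFinP; apply: (measurableT_comp ms).
Qed.

(** [u x] is the probability of being in [B] after [q] steps from [x], obtained by iterating the
    kernel; one [u] serves all times [t]. The density of the q-step law enters only later, through
    the law of a pair. *)
Lemma markov_iterate q B : measurable B -> exists u : T -> \bar R,
  [/\ measurable_fun setT u, forall x, (0 <= u x <= 1)%E &
      forall t G, past t G ->
        P (G `&` X (t + q)%N @^-1` B) = (\int[P]_(w in G) u (X t w))%E].
Proof.
move=> mB; elim: q => [|q [u [mu_ u01 hu]]].
  exists (fun x => (\1_B x)%:E); split.
  - exact: measurable_EFin_indic.
  - by move=> x; rewrite indicE; case: (x \in B); rewrite lexx lee01.
  - move=> t G pG; have mG := past_measurable pG.
    rewrite addn0 (_ : (fun w => _) = (fun w => (\1_(X t @^-1` B) w)%:E))//.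
    have mXB : measurable (X t @^-1` B) by exact: measurable_funPTI.
    by rewrite (integral_indic P mG mXB) setIC.
have u0 x : (0 <= u x)%E by case/andP: (u01 x).
exists (fun x => \int[mu]_y (u y * (s (x, y))%:E))%E; split.
- apply: (measurable_fun_fubini_tonelli_F (fun z => u z.2 * (s z)%:E)%E).
    apply: emeasurable_funM; last exact/measurable_EFinP.
    exact: measurableT_comp.
  by move=> z; rewrite mule_ge0// lee_fin.
- move=> x; apply/andP; split.
    by apply: integral_ge0 => y _; rewrite mule_ge0// lee_fin.
  rewrite -(s1 x); apply: ge0_le_integral_nonmeas => y.
    by rewrite mule_ge0// lee_fin.
  by rewrite -[leRHS]mul1e lee_wpmul2r ?lee_fin//; case/andP: (u01 y).
- move=> t G pG; rewrite addnS -addSn hu; last exact: past_mono pG.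
  exact: markov_expectation.
Qed.

Hypothesis (sX : stationary X) (phiX : has_density (X 0%N) phi).

Let pr A := fine (P A).

Let prE A : measurable A -> P A = (pr A)%:E.
Proof. by move=> mA; rewrite fineK// fin_num_measure. Qed.

Let mXi t (A : set T) : measurable A -> measurable (X t @^-1` A).
Proof. by move=> mA; exact: measurable_funPTI. Qed.

(** With r the stationary probability of [B], the excess of P(G, X_(t+q) in B) over r P(G) is the
    integral over [G] of u(X_t) - r. It is largest when [G] is the event u(X_t) >= r, which depends
    on X_t alone, so the law of the pair and beta_q bound it. *)
Lemma past_mixing_le t q G B p (b : R) : past t G -> measurable B ->
  cond_density (X 0%N) (X q) p -> beta_coef p phi = b%:E ->
  fine (P (G `&` X (t + q)%N @^-1` B)) <=
  fine (P G) * fine (P (X 0%N @^-1` B)) + b.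
Proof.
move=> pG mB hp hb; have mG := past_measurable pG.
have [u [mu_ u01 hu]] := markov_iterate q mB.
set r := fine (P (X 0%N @^-1` B)).
pose A := [set x | r%:E <= u x]%E.
have mA : measurable A.
  by rewrite -[X in measurable X]setTI; exact: emeasurable_fun_c_infty.
pose A' := X t @^-1` A; pose B' := X (t + q)%N @^-1` B.
have mA' : measurable A' by exact: mXi.
have mB' : measurable B' by exact: mXi.
have pA' : past t A' by exact: past_preimage.
have up H : past t H -> H `<=` ~` A' -> pr (H `&` B') <= r * pr H.
  move=> pH HA; have mH := past_measurable pH.
  rewrite -lee_fin EFinM -(prE mH) -(prE (measurableI _ _ mH mB')).
  rewrite /B' hu// -[leRHS]integral_cst//.
  apply: ge0_le_integral => //.
  - by move=> w _; case/andP: (u01 (X t w)).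
  - by apply: measurable_funTS; exact: measurableT_comp.
  - move=> w /HA /= /negP; rewrite -ltNge; exact: ltW.
have lo H : past t H -> H `<=` A' -> r * pr H <= pr (H `&` B').
  move=> pH HA; have mH := past_measurable pH.
  rewrite -lee_fin EFinM -(prE mH) -(prE (measurableI _ _ mH mB')).
  rewrite /B' hu// -[leLHS]integral_cst//.
  apply: ge0_le_integral => //.
  - by move=> w _; rewrite lee_fin fine_ge0.
  - by apply: measurable_funTS; exact: measurableT_comp.
have h1 := up (G `&` ~` A') (past_setI pG (past_setC pA')) (@subIsetr _ _ _).
have h2 := lo (A' `&` ~` G) (past_setI pA' (past_setC pG)) (@subIsetl _ _ _).
have h3 : pr (A' `&` B') <= pr A' * r + b.
  rewrite -lee_fin EFinD EFinM -(prE mA') -(prE (measurableI _ _ mA' mB')).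
  rewrite /A' /B' stationary_pair// stationary_marginal// -hb /r -[fine _]/(pr _) -prE; last exact: mXi.
  exact: (cond_density_pair sX phiX).
(* [G] and [A'] are cut along each other; the parts over their intersection cancel in the final
   linear arithmetic. *)
have e1 := fine_prob_split P (measurableI _ _ mG mB') mA'.
have e2 := fine_prob_split P (measurableI _ _ mA' mB') mG.
have e3 := fine_prob_split P mG mA'.
have e4 := fine_prob_split P mA' mG.
have i1 : G `&` B' `&` A' = A' `&` B' `&` G by rewrite setIAC [RHS]setIAC (setIC G).
have i2 : G `&` B' `&` ~` A' = G `&` ~` A' `&` B' by rewrite setIAC.
have i3 : A' `&` B' `&` ~` G = A' `&` ~` G `&` B' by rewrite setIAC.
rewrite i1 i2 in e1; rewrite i3 in e2; rewrite (setIC A' G) in e4.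
have e3r := congr1 (fun x => r * x) e3; have e4r := congr1 (fun x => r * x) e4.
rewrite /= !mulrDr in e3r e4r; rewrite /pr in h1 h2 h3; rewrite -/B'.
lra.
Qed.

(** This is the upper bound applied to the complement of [B]. *)
Lemma past_mixing_ge t q G B p (b : R) : past t G -> measurable B ->
  cond_density (X 0%N) (X q) p -> beta_coef p phi = b%:E ->
  fine (P G) * fine (P (X 0%N @^-1` B)) - b <=
  fine (P (G `&` X (t + q)%N @^-1` B)).
Proof.
move=> pG mB hp hb; have mG := past_measurable pG.
have h : fine (P (G `&` ~` (X (t + q)%N @^-1` B))) <=
    fine (P G) * fine (P (~` (X 0%N @^-1` B))) + b :=
  past_mixing_le pG (measurableC mB) hp hb.
have e1 := fine_prob_split P mG (mXi (t + q) mB).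
have e2 := fine_prob_split P measurableT (mXi 0 mB).
rewrite !setTI probability_setT /= in e2.
have e3 := congr1 (fun x => fine (P G) * x) e2; rewrite /= mulrDr mulr1 in e3.
lra.
Qed.

End markov_mixing.

(** * Visits to a set *)

Section skeleton.
Context (R : realType) (d : nat) (disp : measure_display)
  (Omega : measurableType disp) (P : probability Omega R).
Local Notation T := (d.-tuple R).
Variables (X : nat -> {RV P >-> T}) (s : T * T -> R) (phi : T -> R).
Hypothesis (mX : markov_chain X s) (sX : stationary X)
  (phiX : has_density (X 0%N) phi).
Variables (q : nat) (sq : T * T -> R) (b : R).
Hypothesis (sqX : cond_density (X 0%N) (X q) sq) (bE : beta_coef sq phi = b%:E).
Variables (I : set T).
Hypothesis mI : measurable I.

Let pr A := fine (P A).
Let p := pr (X 0%N @^-1` I).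

Let prE A : measurable A -> P A = (pr A)%:E.
Proof. by move=> mA; rewrite fineK// fin_num_measure. Qed.

Let mXi t : measurable (X t @^-1` I).
Proof. exact: measurable_funPTI. Qed.

Let p0 : 0 <= p. Proof. exact: fine_ge0. Qed.

Let p1 : p <= 1.
Proof. by rewrite -lee_fin -prE// probability_le1. Qed.

Let b0 : 0 <= b.
Proof.
rewrite -lee_fin -bE; apply: integral_ge0 => z _; rewrite lee_fin mulr_ge0//.
by case: phiX.
Qed.

Definition visits (r N : nat) (w : Omega) : nat :=
  \sum_(k < N) (X (r + k * q)%N w \in I : nat).

Lemma visitsS r N w :
  visits r N.+1 w = (visits r N w + (X (r + N * q)%N w \in I))%N.
Proof. by rewrite /visits big_ord_recr. Qed.

Lemma visits_le r N w : (visits r N w <= N)%N.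
Proof.
by elim: N => [|N IH]; rewrite ?/visits ?big_ord0// -/(visits _ _ _) visitsS -addn1 leq_add// leq_b1.
Qed.

(** The induction runs over all predicates, since a visit at the last index shifts the count by
    one. *)
Lemma past_visits r N t (Q : pred nat) : (forall k, (k < N)%N -> (r + k * q <= t)%N) ->
  past X t [set w | Q (visits r N w)].
Proof.
elim: N Q => [|N IH] Q h.
  rewrite (_ : [set w | _] = if Q 0%N then setT else set0); last first.
    by apply/seteqP; split => w /=; rewrite /visits big_ord0; case: (Q 0%N).
  by case: (Q 0%N); [rewrite -(setC0); apply: past_setC|]; exact: sigma_algebra0.
have {}IH (Q' : pred nat) : past X t [set w | Q' (visits r N w)].
  by apply: IH => k kN; apply: h; exact: leqW.
have pI : past X t (X (r + N * q)%N @^-1` I).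
  exact: past_preimage (h N (ltnSn N)) mI.
rewrite (_ : [set w | _] =
   [set w | Q (visits r N w).+1] `&` (X (r + N * q)%N @^-1` I) `|`
   [set w | Q (visits r N w)] `&` ~` (X (r + N * q)%N @^-1` I)).
  apply: past_setU; apply: past_setI => //; last exact: past_setC.
  exact: (IH (fun j => Q j.+1)).
apply/seteqP; split => w /=; rewrite visitsS.
  have [/set_mem wI|/negP wI] := boolP (X _ w \in I).
    by rewrite addn1; left.
  by rewrite addn0; right; split => // /mem_set.
by move=> [[Qw /mem_set ->]|[Qw wI]]; rewrite ?addn1// memNset ?addn0.
Qed.

Let ev r N (Q : pred nat) := [set w | Q (visits r N w)].

Let mev r N Q : measurable (ev r N Q).
Proof.
apply: (@past_measurable _ _ _ _ X (r + N * q)); apply: (past_visits Q) => k kN.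
by rewrite leq_add2l leq_mul2r ltnW ?orbT.
Qed.

Lemma visits_mixing r N (Q : pred nat) :
  `|pr (ev r N Q `&` X (r + N * q)%N @^-1` I) - p * pr (ev r N Q)| <= b.
Proof.
case: N => [|N].
  (* Index [r] has no predecessor in its subsequence: the event is trivial and stationarity gives an
     exact equality. *)
  rewrite mul0n addn0.
  have -> : ev r 0 Q = if Q 0%N then setT else set0.
    by apply/seteqP; split => w /=; rewrite /ev /= /visits big_ord0; case: (Q 0%N).
  case: (Q 0%N); last by rewrite set0I /pr measure0 mulr0 subrr normr0.
  by rewrite setTI /p /pr probability_setT mulr1 stationary_marginal// subrr normr0.
have pG : past X (r + N * q) (ev r N.+1 Q).
  by apply: past_visits => k kN; rewrite leq_add2l leq_mul2r -ltnS kN orbT.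
have e : (r + N.+1 * q = r + N * q + q)%N by rewrite mulSnr addnA.
have h1 := past_mixing_le mX sX phiX pG mI sqX bE.
have h2 := past_mixing_ge mX sX phiX pG mI sqX bE.
rewrite -e in h1 h2; rewrite ler_norml /p /pr mulrC; apply/andP.
by split; lra.
Qed.

Lemma visits_sum r N (Q : pred nat) C : measurable C ->
  \sum_(j < N.+1 | Q j) pr (ev r N (pred1 (j : nat)) `&` C) = pr (ev r N Q `&` C).
Proof.
move=> mC.
have -> : ev r N Q `&` C =
    \big[setU/set0]_(j < N.+1 | Q j) (ev r N (pred1 (j : nat)) `&` C).
  apply/seteqP; split => w.
    move=> [Qw Cw]; rewrite -bigcup_seq_cond.
    have h : (visits r N w < N.+1)%N by rewrite ltnS visits_le.
    exists (Ordinal h); first by rewrite /= mem_index_enum.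
    by split => //; rewrite /ev /=.
  rewrite -bigcup_seq_cond => -[j /andP[_ Qj] [/eqP/= e Cw]].
  by split => //; rewrite /ev /= e.
apply/EFin_inj; rewrite -sumEFin -prE; last first.
  by apply: bigsetU_measurable => j _; apply: measurableI.
rewrite (measure_bigsetU_ord P (fun j : 'I_N.+1 => Q j)).
- by apply: eq_bigr => j _; rewrite -prE//; apply: measurableI.
- by move=> j; apply: measurableI.
- apply/trivIsetP => i j _ _ ij; apply/seteqP; split => // w [[/eqP/= e1 _] [/eqP/= e2 _]].
  by move: ij; rewrite -(inj_eq val_inj) /= -e1 -e2 eqxx.
Qed.

(** Passing from [N] to [N.+1] moves the mass [h r N j] of the law [a r N] from j to j + 1; [a0] and
    [aS] below are this recurrence. *)
Let a r N j := pr (ev r N (pred1 j)).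
Let h r N j := pr (ev r N (pred1 j) `&` X (r + N * q)%N @^-1` I).

Let a_out r N : a r N N.+1 = 0.
Proof.
rewrite /a (_ : ev r N _ = set0) ?/pr ?measure0//.
by apply/seteqP; split => // w /= /eqP e; have := visits_le r N w; rewrite e ltnn.
Qed.

Let h_out r N : h r N N.+1 = 0.
Proof.
rewrite /h (_ : ev r N _ = set0) ?set0I ?/pr ?measure0//.
by apply/seteqP; split => // w /= /eqP e; have := visits_le r N w; rewrite e ltnn.
Qed.

Let a0 r N : a r N.+1 0 = a r N 0 - h r N 0.
Proof.
rewrite /a /h /pr (fine_prob_split P (mev r N (pred1 0%N)) (mXi (r + N * q))).
rewrite addrAC subrr add0r.
congr (fine (P _)); apply/seteqP; split => w; rewrite /ev /= visitsS.
  by rewrite addn_eq0 => /andP[-> ]; case: (boolP (_ \in _)) => // /negP wI _; split => // /mem_set.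
by move=> [/eqP -> wI]; rewrite memNset.
Qed.

Let aS r N j : a r N.+1 j.+1 = h r N j + a r N j.+1 - h r N j.+1.
Proof.
rewrite /a /h /pr (fine_prob_split P (mev r N (pred1 j.+1)) (mXi (r + N * q))).
rewrite -addrA [X in _ + X]addrAC subrr add0r.
rewrite (fine_prob_split P (mev r N.+1 (pred1 j.+1)) (mXi (r + N * q))).
congr (fine (P _) + fine (P _)); apply/seteqP; split => w; rewrite /ev /= visitsS => -[+ wI].
- by rewrite mem_set// addn1 eqSS.
- by rewrite mem_set// addn1 eqSS.
- by rewrite memNset// addn0.
- by rewrite memNset// addn0.
Qed.

(** If the next index were a visit with probability p independently of the count, [h r N j] would
    equal [p * a r N j] and there would be no error. The defect is at most the sum of the absolute
    differences; cut by sign, it becomes two events on the count, each contributing at most [b]. *)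
Lemma visits_step r N (G : nat -> R) : (forall j, 0 <= G j <= 1) ->
  \sum_(j < N.+2) a r N.+1 j * G j <=
  \sum_(j < N.+1) a r N j * ((1 - p) * G j + p * G j.+1) + 2 * b.
Proof.
move=> G01.
(* Through the recurrence the defect appears with coefficient [G j.+1 - G j], of absolute value at
   most 1; the boundary term vanishes because the count cannot exceed [N]. *)
have -> : \sum_(j < N.+2) a r N.+1 j * G j =
    \sum_(j < N.+1) (a r N j * ((1 - p) * G j + p * G j.+1) +
       (h r N j - p * a r N j) * (G j.+1 - G j)).
  rewrite big_ord_recl /= a0.
  under eq_bigr do rewrite /bump /= add1n aS.
  transitivity (\sum_(j < N.+1) h r N j * G j.+1 +
     \sum_(j < N.+2) (a r N j - h r N j) * G j).
    rewrite [X in _ = _ + X]big_ord_recl /= [RHS]addrCA; congr (_ + _).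
    rewrite -big_split /=; apply: eq_bigr => j _; rewrite /bump /= add1n; ring.
  rewrite [X in _ + X]big_ord_recr /= a_out h_out subrr mul0r addr0.
  by rewrite -big_split /=; apply: eq_bigr => j _; ring.
rewrite big_split /= lerD2l.
pose Q (j : nat) := 0 <= h r N j - p * a r N j.
apply: (@le_trans _ _ (\sum_(j < N.+1) `|h r N j - p * a r N j|)).
  apply: ler_sum => j _; apply: (le_trans (ler_norm _)); rewrite normrM.
  rewrite ler_piMr// ler_norml; have := G01 j; have := G01 j.+1; lra.
have hs (Q' : pred nat) : \sum_(j < N.+1 | Q' j) (h r N j - p * a r N j) =
    pr (ev r N Q' `&` X (r + N * q)%N @^-1` I) - p * pr (ev r N Q').
  rewrite sumrB -mulr_sumr visits_sum//.
  have e := visits_sum r N Q' measurableT; rewrite setIT in e.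
  by rewrite -e; congr (_ - _ * _); apply: eq_bigr => j _; rewrite setIT.
rewrite (bigID (fun j : 'I_N.+1 => Q j)) /=.
rewrite (eq_bigr (fun j : 'I_N.+1 => h r N j - p * a r N j)); last first.
  by move=> j Qj; rewrite ger0_norm.
rewrite [X in _ + X](eq_bigr (fun j : 'I_N.+1 => - (h r N j - p * a r N j))); last first.
  by move=> j /negP; rewrite /Q => /negP; rewrite -ltNge => Qj; rewrite ltr0_norm.
rewrite sumrN (hs Q) (hs (fun j => ~~ Q j)).
have := visits_mixing r N Q; have := visits_mixing r N (fun j => ~~ Q j).
rewrite !ler_norml; lra.
Qed.

(** Both bounds on [G] are stable under the averaging of one step. Values in [0, 1] keep each error
    at 2b, whereas working with c exp(-j) itself would multiply the errors by c; domination by c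
    exp(-j) gives the Laplace transform of a Bernoulli variable as factor at each step. *)
Lemma visits_bound r N (G : nat -> R) c : (forall j, 0 <= G j <= 1) ->
  (forall j, G j <= c * expR (- j%:R)) ->
  \sum_(j < N.+1) a r N j * G j <=
  c * (1 - p + p * expR (- 1)) ^+ N + N%:R * (2 * b).
Proof.
elim: N G c => [|N IH] G c G01 Gc.
  rewrite big_ord1 /= mul0r addr0 expr0.
  have -> : a r 0 0 = 1.
    rewrite /a (_ : ev r 0 _ = setT) ?/pr ?probability_setT//.
    by apply/seteqP; split => // w _; rewrite /ev /= /visits big_ord0.
  by have := Gc 0%N; rewrite oppr0 expR0 mul1r.
apply: (le_trans (visits_step r N G01)).
have -> : N.+1%:R * (2 * b) = N%:R * (2 * b) + 2 * b.
  by rewrite -addn1 natrD; ring.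
rewrite addrA lerD2r exprS [X in _ <= X + _]mulrA.
apply: (IH (fun j => (1 - p) * G j + p * G j.+1) (c * (1 - p + p * expR (- 1)))) => j.
  have := G01 j; have := G01 j.+1; have := p0; have := p1; nra.
have -> : c * (1 - p + p * expR (- 1)) * expR (- j%:R) =
  (1 - p) * (c * expR (- j%:R)) + p * (c * expR (- j.+1%:R)).
  by rewrite -[j.+1]addn1 natrD opprD expRD; ring.
by apply: lerD; apply: ler_wpM2l => //; rewrite subr_ge0.
Qed.

Lemma visits_deviation r N :
  pr [set w | (visits r N w)%:R <= N%:R * p / 4] <=
  expR (- (N%:R * p / 5)) + 2 * N%:R * b.
Proof.
pose Q (j : nat) := (j%:R : R) <= N%:R * p / 4.
rewrite -/(ev r N Q) -(setIT (ev r N Q)) -visits_sum//.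
rewrite big_mkcond /=.
under eq_bigr do rewrite setIT.
rewrite (eq_bigr (fun j : 'I_N.+1 => a r N j * (Q j)%:R)); last first.
  by move=> j _; case: (Q j); rewrite ?mulr1 ?mulr0.
(* The indicator of j <= Np/4 is at most exp(Np/4 - j). *)
apply: (le_trans (@visits_bound r N (fun j => (Q j)%:R) (expR (N%:R * p / 4)) _ _)).
- by move=> j; case: (Q j); rewrite ?lexx ?ler01.
- move=> j; rewrite -expRD; case: (boolP (Q j)) => [Qj|_]; last exact: expR_ge0.
  by rewrite -[leLHS]expR0 ler_expR subr_ge0.
rewrite [N%:R * (2 * b)]mulrCA mulrA lerD2r.
(* Since exp(-1) <= 1/2, the Bernoulli factor is at most 1 - p/2 <= exp(-p/2). The exponent Np/4 -
   Np/2 = -Np/4 is then relaxed to -Np/5. *)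
have e12 : expR (- 1 : R) <= 2^-1.
  rewrite expRN lef_pV2 ?posrE ?expR_gt0//.
  by have := expR_ge1Dx (1 : R); lra.
have e0 := expR_ge0 (- 1 : R).
have rho0 : 0 <= 1 - p + p * expR (- 1) by have := p0; have := p1; nra.
have hrho : 1 - p + p * expR (- 1) <= expR (- (p / 2)).
  apply: le_trans (expR_ge1Dx _); have := p0; nra.
have hN : (1 - p + p * expR (- 1)) ^+ N <= expR (- (p / 2)) ^+ N.
  by apply: lerXn2r; rewrite ?nnegrE ?expR_ge0.
apply: (le_trans (ler_wpM2l (expR_ge0 _) hN)).
rewrite -expRM_natl -expRD ler_expR.
have : 0 <= N%:R * p by rewrite mulr_ge0.
rewrite mulrN; lra.
Qed.

End skeleton.

(** * Gathering the interleaved subsequences *)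

Section occupation.
Context (R : realType) (d : nat) (disp : measure_display)
  (Omega : measurableType disp) (P : probability Omega R).
Local Notation T := (d.-tuple R).
Variables (X : nat -> {RV P >-> T}).
Variables (I : set T).
Hypothesis mI : measurable I.

Definition occupation (n : nat) (w : Omega) : nat :=
  \sum_(i < n) (X i w \in I : nat).

Lemma sum_visits q N w :
  (\sum_(r < q) visits X q I r N w)%N = occupation (N * q) w.
Proof.
elim: N => [|N IH].
  by rewrite mul0n /occupation big_ord0 big1// => r _; rewrite /visits big_ord0.
under eq_bigr do rewrite visitsS.
rewrite big_split /= IH /occupation mulSn (addnC q) big_split_ord /=; congr (_ + _)%N.
by apply: eq_bigr => r _; rewrite addnC.
Qed.

Lemma occupation_mono m n w : (m <= n)%N -> (occupation m w <= occupation n w)%N.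
Proof.
move=> mn; rewrite -(subnKC mn) /occupation big_split_ord /=.
exact: leq_addr.
Qed.

Lemma measurable_visits q r N (Q : pred nat) :
  measurable [set w | Q (visits X q I r N w)].
Proof.
apply: (@past_measurable _ _ _ _ X (r + N * q)); apply: (past_visits mI) => k kN.
by rewrite leq_add2l leq_mul2r ltnW ?orbT.
Qed.

Lemma measurable_occupation n (Q : pred nat) :
  measurable [set w | Q (occupation n w)].
Proof.
rewrite (_ : [set w | _] = [set w | Q (visits X 1 I 0 n w)]).
  exact: measurable_visits.
by congr mkset; apply/funext => w; rewrite -[in LHS](muln1 n) -sum_visits big_ord1.
Qed.

Variables (s : T * T -> R) (phi : T -> R).
Hypothesis (mX : markov_chain X s) (sX : stationary X)
  (phiX : has_density (X 0%N) phi).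
Variables (q : nat) (sq : T * T -> R) (b : R).
Hypothesis (sqX : cond_density (X 0%N) (X q) sq) (bE : beta_coef sq phi = b%:E).
Variable n : nat.
Hypothesis (q0 : (0 < q)%N) (qn : (q <= n)%N).

Let p := fine (P (X 0%N @^-1` I)).
Let N := (n %/ q)%N.

Lemma occupation_deviation :
  fine (P [set w | (occupation n w)%:R < n%:R * p / 16]) <=
  2 * (expR (- (N%:R * p / 5)) + 2 * N%:R * b).
Proof.
set bad := [set w | _].
pose Z r := [set w | (visits X q I r N w)%:R <= N%:R * p / 4].
have mZ r : measurable (Z r) by exact: (measurable_visits q r N (fun j => j%:R <= _)).
have mbad : measurable bad by exact: (measurable_occupation n (fun j => j%:R < _)).
have p0 : 0 <= p by exact: fine_ge0.
(* As q <= n, the quotient is at least 1 and rounding loses at most half of [n]. *)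
have hN : n%:R <= 2 * (q%:R * N%:R) :> R.
  rewrite -!natrM ler_nat /N; have := divn_eq n q; have := ltn_pmod n q0.
  have : (0 < n %/ q)%N by rewrite divn_gt0.
  move: (n %/ q)%N (n %% q)%N => k l k0 lq ->; nia.
(* If fewer than q/2 of the events [Z r] occurred, more than q/2 subsequences would have at least
   Np/4 visits each, a total of at least qNp/8 >= np/16. *)
have key w : \1_bad w * (q%:R / 2) <= \sum_(r < q) (\1_(Z r) w : R).
  rewrite indicE; case: (boolP (w \in bad)) => [|_]; last first.
    by rewrite mul0r sumr_ge0.
  rewrite inE /bad /= mul1r => hw; rewrite leNgt; apply/negP => hZ.
  have h1 : \sum_(r < q) (1 - \1_(Z r) w) * (N%:R * p / 4) <=
      \sum_(r < q) (visits X q I r N w)%:R.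
    apply: ler_sum => r _; rewrite indicE; case: (boolP (w \in Z r)).
      by rewrite subrr mul0r.
    by rewrite subr0 mul1r notin_setE => /negP; rewrite -ltNge; exact: ltW.
  have e : \sum_(r < q) (visits X q I r N w)%:R = (occupation (N * q) w)%:R :> R.
    by rewrite -sum_visits natr_sum.
  rewrite -mulr_suml sumrB sumr_const card_ord e in h1.
  have h2 : (occupation (N * q) w)%:R <= (occupation n w)%:R :> R.
    by rewrite ler_nat occupation_mono// leq_trunc_div.
  have h3 : 0 <= N%:R * p by rewrite mulr_ge0.
  have h4 : n%:R * p <= 2 * q%:R * (N%:R * p).
    by have := ler_wpM2r p0 hN; rewrite -!mulrA.
  have h5 := le_trans h1 h2.
  have h6 : q%:R / 2 * (N%:R * p / 4) <= (1 *+ q - \sum_(r < q) (\1_(Z r) w : R)) * (N%:R * p / 4).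
    apply: ler_wpM2r; first by lra.
    have : (1 *+ q : R) = q%:R by [].
    lra.
  lra.
have : fine (P bad) * (q%:R / 2) <= \sum_(r < q) fine (P (Z r)).
  rewrite -lee_fin EFinM fineK ?fin_num_measure// -sumEFin.
  have -> : (P bad * (q%:R / 2)%:E = \int[P]_w (\1_bad w * (q%:R / 2))%:E)%E.
    under eq_integral do rewrite EFinM.
    have mb := @measurable_EFin_indic _ _ R _ mbad.
    rewrite (ge0_integralZr _ measurableT mb).
    - by rewrite integral_indic// setIT.
    - by move=> w _; rewrite lee_fin.
    - by rewrite lee_fin divr_ge0.
  have -> : (\sum_(r < q) (fine (P (Z r)))%:E = \int[P]_w (\sum_(r < q) (\1_(Z r) w)%:E))%E.
    rewrite ge0_integral_sum//; last by move=> r; exact: measurable_EFin_indic.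
    apply: eq_bigr => r _.
    by rewrite fineK ?fin_num_measure// integral_indic// setIT.
  apply: ge0_le_integral_nonmeas => w; first by rewrite lee_fin mulr_ge0// divr_ge0.
  by rewrite sumEFin lee_fin.
have : \sum_(r < q) fine (P (Z r)) <= \sum_(r < q) (expR (- (N%:R * p / 5)) + 2 * N%:R * b).
  by apply: ler_sum => r _; exact: (visits_deviation mX sX phiX sqX bE mI).
rewrite sumr_const card_ord -[_ *+ q]mulr_natl => h1 h2.
have := le_trans h2 h1.
rewrite [leRHS](_ : _ = 2 * (expR (- (N%:R * p / 5)) + 2 * N%:R * b) * (q%:R / 2)); last by field.
by rewrite ler_pM2r// divr_gt0// ltr0n.
Qed.

(** The 10 arises from N >= n/(2q) in the exponent Np/5; the bound [k] will be the least mass of a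
    cell. *)
Lemma occupation_deviation_explicit k : 0 < k -> k <= p ->
  fine (P [set w | (occupation n w)%:R < n%:R * p / 16]) <=
  4 * (expR (- (k / 10 * (n%:R / q%:R))) + n%:R * b / q%:R).
Proof.
move=> k0 kp; apply: (le_trans occupation_deviation).
have qR : 0 < q%:R :> R by rewrite ltr0n.
have b0 : 0 <= b.
  rewrite -lee_fin -bE; apply: integral_ge0 => z _; rewrite lee_fin mulr_ge0//.
  by case: phiX.
have hN : n%:R / q%:R <= 2 * N%:R :> R.
  rewrite ler_pdivrMr// -!natrM ler_nat /N; have := divn_eq n q; have := ltn_pmod n q0.
  have : (0 < n %/ q)%N by rewrite divn_gt0.
  move: (n %/ q)%N (n %% q)%N => j l j0 lq ->; nia.
have Nn : N%:R <= n%:R / q%:R :> R.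
  by rewrite ler_pdivlMr// -natrM ler_nat leq_trunc_div.
have e1 : expR (- (N%:R * p / 5)) <= expR (- (k / 10 * (n%:R / q%:R))).
  rewrite ler_expR lerN2.
  have h1 : k * (n%:R / q%:R) <= k * (2 * N%:R) by rewrite ler_pM2l.
  have h2 : k * N%:R <= p * N%:R by rewrite ler_wpM2r.
  lra.
have e2 : N%:R * b <= n%:R / q%:R * b by rewrite ler_wpM2r.
have e0 := expR_ge0 (- (k / 10 * (n%:R / q%:R))).
have -> : n%:R * b / q%:R = n%:R / q%:R * b by rewrite mulrAC.
lra.
Qed.

End occupation.

(** * Histograms *)

Section histograms.
Context (R : realType) (d : nat).
Local Notation T := (d.-tuple R).
Local Notation mu := (lebesgue_vec R d).
Hypothesis d1 : (1 <= d)%N.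
Variables (l : nat) (m : set (set (T * T))).
Hypothesis ml : partitions_fin l m.

Lemma partition_cells (K : set (T * T)) : m K ->
  exists j, (j <= l)%N /\ exists c c', K = @cell R d j c `*` @cell R d j c'.
Proof.
by move=> /(partitions_finP d1 ml).1[j jl /dyadic_cubesP h]; exists j.
Qed.

Lemma partition_sub_unit (K : set (T * T)) : m K -> K `<=` @unit_cube R d.
Proof. by move=> /(partitions_finP d1 ml).1[j _]; exact: dyadic_cubes_sub_unit. Qed.

Lemma partition_measurable (K : set (T * T)) : m K -> measurable K.
Proof.
by move=> /partition_cells[j [_ [c [c' ->]]]]; apply: measurableX; exact: measurable_cell.
Qed.

Let mfin : finite_set m := partition_finite d1 ml.

(** Coefficients and evaluation point both depend on the parameter, which covers the histogram, with
    its random coefficients, evaluated at a random first coordinate. *)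
Lemma measurable_pw (disp : measure_display) (Om : measurableType disp)
    (g : Om -> T * T) (a : set (T * T) -> Om -> R) :
  measurable_fun setT g -> (forall K, m K -> measurable_fun setT (a K)) ->
  measurable_fun setT (fun w => \sum_(K \in m) a K w * \1_K (g w)).
Proof.
move=> mg ma; under eq_fun do rewrite fsbig_finite//.
(* Terms outside [m] are replaced by 0 so that every summand is measurable. *)
have -> : (fun w => \sum_(K <- finmap.enum_fset (fset_set m)) a K w * \1_K (g w)) =
  (fun w => \sum_(K <- finmap.enum_fset (fset_set m))
     (if K \in m then a K w * \1_K (g w) else 0)).
  apply/funext => w; rewrite !big_seq; apply: eq_bigr => K.
  by rewrite in_fset_set// => ->.
apply: measurable_sum => K; case: (boolP (K \in m)) => [|_]; last exact: measurable_cst.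
rewrite inE => mK; apply: measurable_funM; first exact: ma.
apply: (measurableT_comp _ mg); apply: measurable_indic.
exact: partition_measurable.
Qed.

Lemma pw_const_ge0 f z : pw_const m f -> 0 <= f z.
Proof. by move=> [a [a0 ->]]; apply: fsumr_ge0 => K _; rewrite mulr_ge0. Qed.

Lemma pw_const_measurable f : pw_const m f -> measurable_fun setT f.
Proof.
move=> [a [a0 ->]]; apply: (measurable_pw (a := fun K _ => a K)).
  exact: measurable_id.
by move=> K _; exact: measurable_cst.
Qed.

Lemma pw_const_supp f z : pw_const m f -> ~ unit_cube z -> f z = 0.
Proof.
move=> [a [a0 ->]] hz; apply: fsbig1 => K mK.
by rewrite indicE memNset ?mulr0// => /(partition_sub_unit mK).
Qed.

(** The first factor of a cube of level at most [l] contains a level-l cell entirely or misses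
    it. *)
Lemma pw_const_cell f (c : {ffun 'I_d -> 'I_(2 ^ l)}) x x' y : pw_const m f ->
  cell c x -> cell c x' -> f (x, y) = f (x', y).
Proof.
move=> [a [a0 ->]] cx cx'; apply: eq_fsbigr => K; rewrite inE => mK; congr (_ * _).
have [j [jl [b [b' ->]]]] := partition_cells mK.
rewrite !indicE; congr (_ %:R); congr nat_of_bool.
apply/idP/idP; rewrite !inE /= => -[h h']; split => //.
  exact: (cell_refine jl cx cx' h).
exact: (cell_refine jl cx' cx h).
Qed.

Variables (n : nat).

Definition hist_coef (x : nat -> T) (K : set (T * T)) : R :=
  (\sum_(i < n) \1_K (x i, x i.+1)) / (\sum_(i < n) \int[mu]_y \1_K (x i, y)).

Lemma Rintegral_indic_ge0 (K : set (T * T)) x : 0 <= \int[mu]_y (\1_K (x, y) : R).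
Proof. by apply: fine_ge0; apply: integral_ge0 => y _; rewrite lee_fin. Qed.

Lemma hist_pw_const x : pw_const m (hist n x m).
Proof.
exists (hist_coef x); split => // K; rewrite /hist_coef divr_ge0// sumr_ge0// => i _.
exact: Rintegral_indic_ge0.
Qed.

(** For a cube of level j the denominator is 2^(-jd) times the number of points [x i] in its first
    factor, and that number is at least the numerator. If it is 0, the convention 0/0 = 0 gives the
    bound. *)
Lemma hist_coef_le x K : m K -> hist_coef x K <= 2 ^+ (l * d).
Proof.
move=> mK; have [j [jl [c [c' eK]]]] := partition_cells mK.
have RI y : \int[mu]_y' (\1_K (y, y') : R) = \1_(cell c) y / 2 ^+ (j * d).
  rewrite /Rintegral.
  transitivity (fine (\int[mu]_y' ((\1_(cell c) y)%:E * (\1_(cell c') y')%:E)%E)).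
    congr fine; apply: eq_integral => y' _; rewrite -EFinM eK.
    rewrite !indicE; congr (_ %:E); rewrite -natrM mulnb; congr (_ %:R).
    by rewrite in_setX.
  rewrite ge0_integralZl_EFin//; last first.
    by apply: measurable_EFin_indic; exact: measurable_cell.
  rewrite integral_indic//; last exact: measurable_cell.
  by rewrite setIT [X in (_ * X)%E](lebesgue_cell R c').
rewrite /hist_coef; under [X in _ / X]eq_bigr do rewrite RI.
rewrite -mulr_suml.
set num := \sum_(i < n) \1_K _; set den := \sum_(i < n) _.
have nd : num <= den.
  apply: ler_sum => i _; rewrite eK !indicE ler_nat.
  by case: (boolP (_ \in _ `*` _)) => //; rewrite inE /= => -[h _]; rewrite mem_set.
have den0 : 0 <= den by apply: sumr_ge0.
have e2 : (2 : R) ^+ (j * d) <= 2 ^+ (l * d).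
  by rewrite ler_weXn2l ?ler1n// leq_mul2r jl orbT.
rewrite invfM invrK mulrA.
apply: le_trans e2; rewrite ler_piMl ?exprn_ge0//.
have [->|dn0] := eqVneq den 0; first by rewrite invr0 mulr0.
by rewrite ler_pdivrMr ?mul1r// lt_neqAle eq_sym dn0.
Qed.

Lemma hist_le x z : hist n x m z <= 2 ^+ (l * d).
Proof.
rewrite /hist; have [[K mK Kz]|nK] := pselect (exists2 K, m K & K z); last first.
  rewrite fsbig1 ?exprn_ge0// => K mK; rewrite indicE memNset ?mulr0// => Kz.
  by apply: nK; exists K.
rewrite (fsbigD1 K)//= fsbig1 ?addr0.
  rewrite indicE mem_set// mulr1; exact: hist_coef_le.
move=> K' [mK' K'K]; rewrite indicE memNset ?mulr0// => K'z.
by apply: K'K; rewrite /= ((partitions_finP d1 ml).2 K K' z).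
Qed.

End histograms.

(** * Hellinger distances *)

Section hellinger.
Context (R : realType) (d : nat).
Local Notation T := (d.-tuple R).
Local Notation mu := (lebesgue_vec R d).
Implicit Types f g k : T * T -> R.

Lemma measurable_sqrt : measurable_fun setT (@Num.sqrt R).
Proof. by apply: continuous_measurable_fun; exact: sqrt_continuous. Qed.

Lemma measurable_sqrt_dist (disp : measure_display) (U : measurableType disp)
    (a b : U -> R) : measurable_fun setT a -> measurable_fun setT b ->
  measurable_fun setT (fun u => ((Num.sqrt (a u) - Num.sqrt (b u)) ^+ 2)%:E).
Proof.
move=> ma mb; apply/measurable_EFinP; apply: measurable_funX.
by apply: measurable_funB; apply: (measurableT_comp measurable_sqrt).
Qed.

Lemma sqrt_dist_triangle (a b c : R) :
  (Num.sqrt a - Num.sqrt c) ^+ 2 <=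
  2 * (Num.sqrt a - Num.sqrt b) ^+ 2 + 2 * (Num.sqrt b - Num.sqrt c) ^+ 2.
Proof.
move: (Num.sqrt a) (Num.sqrt b) (Num.sqrt c) => x y z.
(* This square is exactly the difference of the two sides. *)
have := sqr_ge0 (x - 2 * y + z); rewrite !expr2; nra.
Qed.

Lemma sqrt_dist_le (a b : R) : 0 <= a -> 0 <= b ->
  (Num.sqrt a - Num.sqrt b) ^+ 2 <= a + b.
Proof.
move=> a0 b0; rewrite sqrrB !sqr_sqrtr// lerD2r lerBlDr lerDl.
by rewrite mulrn_wge0// mulr_ge0// sqrtr_ge0.
Qed.

Lemma mule_triangle (e c : R) (A B C : \bar R) : 0 <= e -> 0 <= c ->
  (0 <= B)%E -> (0 <= C)%E -> (A <= e%:E * B + e%:E * C)%E ->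
  (c%:E * A <= e%:E * (c%:E * B) + e%:E * (c%:E * C))%E.
Proof.
move=> e0 c0 B0 C0 h.
have -> : (e%:E * (c%:E * B) + e%:E * (c%:E * C) = c%:E * (e%:E * B + e%:E * C))%E.
  by rewrite ge0_muleDr ?mule_ge0 ?lee_fin// !muleA (muleC e%:E).
by apply: lee_wpmul2l; rewrite ?lee_fin.
Qed.

Lemma ge0_integral_triangle (disp : measure_display) (U : measurableType disp)
    (nu : {measure set U -> \bar R}) (A B C w : U -> \bar R) (e : R) : 0 <= e ->
  (forall u, 0 <= A u)%E -> (forall u, 0 <= B u)%E -> (forall u, 0 <= C u)%E ->
  (forall u, 0 <= w u)%E ->
  measurable_fun setT B -> measurable_fun setT C -> measurable_fun setT w ->
  (forall u, A u <= e%:E * B u + e%:E * C u)%E ->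
  (\int[nu]_u (A u * w u) <=
   e%:E * \int[nu]_u (B u * w u) + e%:E * \int[nu]_u (C u * w u))%E.
Proof.
move=> e0 A0 B0 C0 w0 mB mC mw h.
have mBw : measurable_fun setT (fun u => B u * w u)%E by exact: emeasurable_funM.
have mCw : measurable_fun setT (fun u => C u * w u)%E by exact: emeasurable_funM.
rewrite -!ge0_integralZl_EFin//; try by move=> u _; rewrite mule_ge0.
have eE : (0 <= e%:E)%E by rewrite lee_fin.
rewrite -ge0_integralD//; try by move=> u _; rewrite !mule_ge0.
- apply: ge0_le_integral_nonmeas => u; first by rewrite mule_ge0.
  by rewrite !muleA -ge0_muleDl ?mule_ge0// lee_wpmul2r.
- by apply: emeasurable_funM => //; exact: measurable_cst.
- by apply: emeasurable_funM => //; exact: measurable_cst.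
Qed.

(** Up to the factor 1/2, [h2] averages this section against phi, for functions supported in the
    unit cube, and [H2] averages it over the data. Comparing the distances thus reduces to functions
    of the first variable. *)
Definition hell_sect f g (x : T) : \bar R :=
  (\int[mu]_y ((Num.sqrt (f (x, y)) - Num.sqrt (g (x, y))) ^+ 2)%:E)%E.

Lemma hell_sect_ge0 f g x : (0 <= hell_sect f g x)%E.
Proof. by apply: integral_ge0 => y _; rewrite lee_fin sqr_ge0. Qed.

Lemma measurable_hell_sect f g : measurable_fun setT f -> measurable_fun setT g ->
  measurable_fun setT (hell_sect f g).
Proof.
move=> mf mg.
apply: (measurable_fun_fubini_tonelli_F (fun z => ((Num.sqrt (f z) - Num.sqrt (g z)) ^+ 2)%:E)).
  exact: measurable_sqrt_dist.
by move=> z; rewrite lee_fin sqr_ge0.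
Qed.

Lemma hell_sect_triangle f g k x : measurable_fun setT f -> measurable_fun setT g ->
  measurable_fun setT k ->
  (hell_sect f k x <= 2%:E * hell_sect f g x + 2%:E * hell_sect g k x)%E.
Proof.
move=> mf mg mk; rewrite /hell_sect.
have mx (h h' : T * T -> R) : measurable_fun setT h -> measurable_fun setT h' ->
    measurable_fun setT (fun y => ((Num.sqrt (h (x, y)) - Num.sqrt (h' (x, y))) ^+ 2)%:E).
  move=> mh mh'; apply: measurable_sqrt_dist.
    exact: (measurableT_comp mh (pair1_measurable x)).
  exact: (measurableT_comp mh' (pair1_measurable x)).
have h0 (h h' : T * T -> R) y : (0 <= ((Num.sqrt (h (x, y)) - Num.sqrt (h' (x, y))) ^+ 2)%:E)%E.
  by rewrite lee_fin sqr_ge0.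
rewrite -!ge0_integralZl_EFin//; try exact: mx.
have mx2 (h h' : T * T -> R) : measurable_fun setT h -> measurable_fun setT h' ->
    measurable_fun setT (fun y => 2%:E * ((Num.sqrt (h (x, y)) - Num.sqrt (h' (x, y))) ^+ 2)%:E)%E.
  by move=> mh mh'; apply: emeasurable_funM => //; exact: mx.
rewrite -ge0_integralD//; last 4 first.
- by move=> y _; rewrite mule_ge0.
- exact: mx2.
- by move=> y _; rewrite mule_ge0.
- exact: mx2.
apply: ge0_le_integral_nonmeas => y //.
by rewrite -!EFinM -EFinD lee_fin sqrt_dist_triangle.
Qed.

(** [h2] integrates over the unit cube and [H2] over the whole space in y; this support condition
    reconciles them. *)
Definition supp_unit f := forall z, ~ @unit_cube R d z -> f z = 0.

Section h2.
Variable phi : T -> R.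
Hypothesis (mphi : measurable_fun setT phi) (phi0 : forall x, 0 <= phi x).

Let mphiE : measurable_fun setT (EFin \o phi). Proof. exact/measurable_EFinP. Qed.

Lemma h2E f g : measurable_fun setT f -> measurable_fun setT g ->
  supp_unit f -> supp_unit g ->
  h2 phi f g = (2^-1%:E * \int[mu]_x (hell_sect f g x * (phi x)%:E))%E.
Proof.
move=> mf mg sf sg; rewrite /h2; congr (_ * _)%E.
have msq := measurable_sqrt_dist mf mg.
have mph : measurable_fun setT (fun z : T * T => (phi z.1)%:E).
  by apply/measurable_EFinP; apply: (measurableT_comp mphi).
transitivity (\int[mu \x mu]_z (((Num.sqrt (f z) - Num.sqrt (g z)) ^+ 2)%:E * (phi z.1)%:E))%E.
  rewrite integral_mkcond; apply: eq_integral => z _; rewrite /patch.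
  case: ifPn => // /negP hz; rewrite sf ?sg; try by move=> /mem_set.
  by rewrite subrr expr0n /= mul0e.
rewrite fubini_tonelli1.
- apply: eq_integral => x _; rewrite /fubini_F /hell_sect /= muleC -ge0_integralZl_EFin//.
  + by apply: eq_integral => y _; rewrite muleC.
  + by move=> y _; rewrite lee_fin sqr_ge0.
  + exact: (measurableT_comp msq (pair1_measurable x)).
- exact: emeasurable_funM.
- by move=> z; rewrite mule_ge0// lee_fin// sqr_ge0.
Qed.

Lemma h2_triangle f g k : measurable_fun setT f -> measurable_fun setT g ->
  measurable_fun setT k -> supp_unit f -> supp_unit g -> supp_unit k ->
  (h2 phi f k <= 2%:E * h2 phi f g + 2%:E * h2 phi g k)%E.
Proof.
move=> mf mg mk sf sg sk; rewrite !h2E//.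
have phiE x : (0 <= (phi x)%:E)%E by rewrite lee_fin.
have I0 a b : (0 <= \int[mu]_x (hell_sect a b x * (phi x)%:E))%E.
  by apply: integral_ge0 => x _; rewrite mule_ge0 ?hell_sect_ge0.
apply: mule_triangle; [by []|by rewrite invr_ge0|exact: I0|exact: I0|].
apply: ge0_integral_triangle => //.
- exact: hell_sect_ge0.
- exact: hell_sect_ge0.
- exact: hell_sect_ge0.
- exact: measurable_hell_sect.
- exact: measurable_hell_sect.
- by move=> x; exact: hell_sect_triangle.
Qed.

Lemma h2_le_mass f g (M M' : R) : measurable_fun setT f -> measurable_fun setT g ->
  supp_unit f -> supp_unit g -> (forall z, 0 <= f z) -> (forall z, 0 <= g z) ->
  (forall x, (\int[mu]_y (f (x, y))%:E <= M%:E)%E) ->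
  (forall x, (\int[mu]_y (g (x, y))%:E <= M'%:E)%E) ->
  (\int[mu]_x (phi x)%:E = 1)%E ->
  (h2 phi f g <= (2^-1 * (M + M'))%:E)%E.
Proof.
move=> mf mg sf sg f0 g0 fM gM phi1; rewrite h2E// EFinM.
apply: lee_wpmul2l; first by rewrite lee_fin invr_ge0.
have sect x : (hell_sect f g x <= (M + M')%:E)%E.
  apply: (@le_trans _ _ (\int[mu]_y ((f (x, y))%:E + (g (x, y))%:E))%E).
    apply: ge0_le_integral_nonmeas => y; first by rewrite lee_fin sqr_ge0.
    by rewrite -EFinD lee_fin sqrt_dist_le.
  rewrite ge0_integralD//.
  - by rewrite EFinD leeD.
  - by move=> y _; rewrite lee_fin.
  - by apply/measurable_EFinP; exact: (measurableT_comp mf (pair1_measurable x)).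
  - by move=> y _; rewrite lee_fin.
  - by apply/measurable_EFinP; exact: (measurableT_comp mg (pair1_measurable x)).
have M0 : 0 <= M + M'.
  by rewrite -lee_fin (le_trans _ (sect [tuple 0 | i < d]))// hell_sect_ge0.
apply: (@le_trans _ _ (\int[mu]_x ((M + M')%:E * (phi x)%:E))%E).
  apply: ge0_le_integral_nonmeas => x.
    by rewrite mule_ge0 ?hell_sect_ge0// lee_fin.
  by apply: lee_wpmul2r => //; rewrite lee_fin.
rewrite ge0_integralZl_EFin//; last by move=> x _; rewrite lee_fin.
by rewrite phi1 mule1.
Qed.

End h2.

Section H2.
Variables (n : nat) (x : nat -> T).

Lemma H2E f g : H2 n x f g = ((2 * n%:R)^-1%:E * \sum_(i < n) hell_sect f g (x i))%E.
Proof. by []. Qed.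

Lemma H2_ge0 f g : (0 <= H2 n x f g)%E.
Proof.
rewrite H2E mule_ge0 ?lee_fin ?invr_ge0//; apply: sume_ge0 => i _.
exact: hell_sect_ge0.
Qed.

Lemma H2_sym f g : H2 n x f g = H2 n x g f.
Proof.
rewrite /H2; congr (_ * _)%E; apply: eq_bigr => i _; apply: eq_integral => y _.
by rewrite -sqrrN opprB.
Qed.

Lemma H2_triangle f g k : measurable_fun setT f -> measurable_fun setT g ->
  measurable_fun setT k ->
  (H2 n x f k <= 2%:E * H2 n x f g + 2%:E * H2 n x g k)%E.
Proof.
move=> mf mg mk; rewrite !H2E.
have S0 a b : (0 <= \sum_(i < n) hell_sect a b (x i))%E.
  by apply: sume_ge0 => i _; exact: hell_sect_ge0.
apply: mule_triangle; [by []|by rewrite invr_ge0 mulr_ge0|exact: S0|exact: S0|].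
rewrite !ge0_sume_distrr; try by move=> i _; exact: hell_sect_ge0.
rewrite -big_split /=; apply: lee_sum => i _; exact: hell_sect_triangle.
Qed.

End H2.

End hellinger.

(** * Stationary and empirical averages of step functions *)

Section step_functions.
Context (R : realType) (d : nat).
Local Notation T := (d.-tuple R).
Local Notation mu := (lebesgue_vec R d).
Variables (l n : nat) (phi : T -> R) (x : nat -> T).
Hypothesis (mphi : measurable_fun setT phi) (phi0 : forall y, 0 <= phi y).
Local Notation idx := {ffun 'I_d -> 'I_(2 ^ l)}.
Variable F : T -> \bar R.
Hypothesis F0 : forall y, (0 <= F y)%E.
Hypothesis Fout : forall y, ~ (forall i, 0 <= tnth y i <= 1) -> F y = 0%E.
Hypothesis Fcell : forall (c : idx) y y', cell c y -> cell c y' -> F y = F y'.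

(** [F (pt c)] is the value of [F] on the cell; the default could occur only for an empty cell,
    whose indicator is 0. *)
Let pt (c : idx) : T := xget [tuple 0 | i < d] (cell c).

Lemma step_decomp y : F y = (\sum_(c : idx) F (pt c) * (\1_(cell c) y)%:E)%E.
Proof.
have [y01|yn] := pselect (forall i, 0 <= tnth y i <= 1); last first.
  rewrite Fout// big1// => c _; rewrite indicE memNset ?mule0// => cy.
  by apply: yn => i; have [] := cy i.
have [c cy] := cell_ex l y01.
rewrite (bigD1 c)//= big1 ?adde0.
  rewrite indicE mem_set// mule1; apply: (Fcell cy).
  by apply: xgetPex; exists y.
move=> c' c'c; rewrite indicE memNset ?mule0// => c'y.
by move: c'c; rewrite (cell_inj c'y cy) eqxx.
Qed.

Lemma step_integral : (\int[mu]_y (F y * (phi y)%:E) =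
  \sum_(c : idx) F (pt c) * \int[mu]_(y in cell c) (phi y)%:E)%E.
Proof.
transitivity (\int[mu]_y (\sum_(c : idx) (F (pt c) * ((phi y)%:E * (\1_(cell c) y)%:E))))%E.
  apply: eq_integral => y _; rewrite [in LHS]step_decomp ge0_sume_distrl.
    by apply: eq_bigr => c _; rewrite -muleA (muleC (phi y)%:E).
  by move=> c _; rewrite mule_ge0 ?lee_fin.
have mI (c : idx) : measurable_fun setT (fun y => (phi y)%:E * (\1_(cell c) y)%:E)%E.
  apply: emeasurable_funM; first exact/measurable_EFinP.
  by apply: measurable_EFin_indic; exact: measurable_cell.
have I0 (c : idx) y : (0 <= (phi y)%:E * (\1_(cell c) y)%:E)%E.
  by rewrite mule_ge0 ?lee_fin.
rewrite ge0_integral_sum//.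
- by apply: eq_bigr => c _; rewrite ge0_integralZl// -integral_mkindic.
- by move=> c; apply: emeasurable_funM => //; exact: measurable_cst.
- by move=> c y _; rewrite mule_ge0.
Qed.

Lemma step_sum : (\sum_(i < n) F (x i) =
  \sum_(c : idx) F (pt c) * ((\sum_(i < n) (x i \in cell c : nat))%N%:R)%:E)%E.
Proof.
under eq_bigr do rewrite step_decomp.
rewrite exchange_big /=; apply: eq_bigr => c _.
rewrite -ge0_sume_distrr; last by move=> i _; rewrite lee_fin.
by rewrite sumEFin natr_sum; congr (_ * (_)%:E)%E; apply: eq_bigr => i _; rewrite indicE.
Qed.

(** Both sides are combinations of the same values [F (pt c)], so it suffices to compare weights:
    [p c] is at most 16/n times the number of visits. *)
Lemma step_integral_le (p : idx -> R) : (0 < n)%N ->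
  (forall c, (\int[mu]_(y in cell c) (phi y)%:E = (p c)%:E)%E) ->
  (forall c, n%:R * p c / 16 <= ((\sum_(i < n) (x i \in cell c : nat))%N)%:R) ->
  ((2^-1)%:E * \int[mu]_y (F y * (phi y)%:E) <=
   16%:E * ((2 * n%:R)^-1%:E * \sum_(i < n) F (x i)))%E.
Proof.
move=> n0 pE good; rewrite step_integral step_sum muleA -EFinM.
rewrite !ge0_sume_distrr; last 2 first.
- by move=> c _; rewrite mule_ge0// lee_fin.
- by move=> c _; rewrite mule_ge0// pE lee_fin -lee_fin -pE integral_ge0// => y _; rewrite lee_fin.
apply: lee_sum => c _; rewrite pE !(muleCA _ (F (pt c))) -!EFinM.
apply: lee_wpmul2l => //; rewrite lee_fin.
have nR : 0 < n%:R :> R by rewrite ltr0n.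
have -> : 2^-1 * p c = 16 / (2 * n%:R) * (n%:R * p c / 16) by field; rewrite gt_eqF.
by apply: ler_wpM2l => //; rewrite divr_ge0// mulr_ge0.
Qed.

End step_functions.

Section comparison.
Context (R : realType) (d : nat).
Local Notation T := (d.-tuple R).
Local Notation mu := (lebesgue_vec R d).
Implicit Types f g : T * T -> R.

Lemma hell_sect_out f g y : supp_unit f -> supp_unit g ->
  ~ (forall i, 0 <= tnth y i <= 1) -> hell_sect f g y = 0%E.
Proof.
move=> sf sg yn; rewrite /hell_sect; apply: integral0_eq => y' _.
have nu : ~ @unit_cube R d (y, y') by move=> h; apply: yn => i; have [] := h i.
by rewrite sf// sg// subrr expr0n.
Qed.

Lemma h2_le_H2 l n (phi : T -> R) (x : nat -> T) f g
    (p : {ffun 'I_d -> 'I_(2 ^ l)} -> R) :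
  measurable_fun setT phi -> (forall y, 0 <= phi y) ->
  measurable_fun setT f -> measurable_fun setT g -> supp_unit f -> supp_unit g ->
  (forall (c : {ffun 'I_d -> 'I_(2 ^ l)}) y y' z,
    cell c y -> cell c y' -> f (y, z) = f (y', z)) ->
  (forall (c : {ffun 'I_d -> 'I_(2 ^ l)}) y y' z,
    cell c y -> cell c y' -> g (y, z) = g (y', z)) ->
  (0 < n)%N ->
  (forall c, (\int[mu]_(y in cell c) (phi y)%:E = (p c)%:E)%E) ->
  (forall c, n%:R * p c / 16 <= ((\sum_(i < n) (x i \in cell c : nat))%N)%:R) ->
  (h2 phi f g <= 16%:E * H2 n x f g)%E.
Proof.
move=> mphi phi0 mf mg sf sg cf cg n0 pE good; rewrite h2E// H2E.
apply: (@step_integral_le _ _ l n phi x mphi phi0 (hell_sect f g) _ _ _ p n0 pE good).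
- exact: hell_sect_ge0.
- by move=> y; exact: hell_sect_out.
- move=> c y y' cy cy'; rewrite /hell_sect; apply: eq_integral => z _.
  by rewrite (cf c y y' z)// (cg c y y' z).
Qed.

End comparison.

Section expectations.
Context (R : realType) (d : nat) (disp : measure_display)
  (Omega : measurableType disp) (P : probability Omega R).
Local Notation T := (d.-tuple R).
Local Notation mu := (lebesgue_vec R d).
Variables (X : nat -> {RV P >-> T}).

Lemma expectation_H2 phi n f g : stationary X -> has_density (X 0%N) phi ->
  (0 < n)%N -> measurable_fun setT f -> measurable_fun setT g ->
  supp_unit f -> supp_unit g ->
  (\int[P]_w H2 n (fun i => X i w) f g = h2 phi f g)%E.
Proof.
move=> sX phiX n0 mf mg sf sg; have [mphi phi0 _] := phiX.
rewrite h2E//; under eq_integral do rewrite H2E.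
have mF := measurable_hell_sect mf mg; have F0 := hell_sect_ge0 f g.
move: (hell_sect f g) mF F0 => F mF F0.
have mFX i : measurable_fun setT (fun w => F (X i w)) by exact: measurableT_comp.
have nR : (n%:R : R) != 0 by rewrite pnatr_eq0 -lt0n.
have mS : measurable_fun setT (fun w => \sum_(i < n) F (X i w))%E by exact: emeasurable_sum.
have S0 w : [set: Omega] w -> (0 <= \sum_(i < n) F (X i w))%E by move=> _; exact: sume_ge0.
rewrite (ge0_integralZl_EFin P measurableT S0 mS); last by rewrite invr_ge0 mulr_ge0.
rewrite ge0_integral_sum//.
under eq_bigr do rewrite (stationary_expectation sX phiX _ mF F0).
set I := integral _ _ _.
have -> : (\sum_(i < n) I = n%:R%:E * I)%E.
  by rewrite mule_natl; elim: n {n0 nR mS S0} => [|k IH]; rewrite ?big_ord0// big_ord_recl IH muleS.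
by rewrite muleA -EFinM; congr (_%:E * _)%E; field.
Qed.

End expectations.

Lemma measurable_fun_select (disp disp' : measure_display)
    (U : measurableType disp) (V : measurableType disp') (I : Type)
    (D : set I) (sel : U -> I) (G : U -> I -> V) : finite_set D ->
  (forall i, D i -> measurable (sel @^-1` [set i])) -> (forall u, D (sel u)) ->
  (forall i, D i -> measurable_fun setT (G^~ i)) ->
  measurable_fun setT (fun u => G u (sel u)).
Proof.
move=> fD msel Dsel mG _ Y mY; rewrite setTI.
rewrite (_ : _ @^-1` Y = \bigcup_(i in D) (sel @^-1` [set i] `&` G^~ i @^-1` Y)).
  apply: fin_bigcup_measurable => // i Di; apply: measurableI; first exact: msel.
  by rewrite -[X in measurable X]setTI; exact: mG.
apply/seteqP; split => u /=; first by exists (sel u).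
by move=> [i _ [/= <-]].
Qed.

(** * Measurability of the loss of the estimator *)

Section measurability.
Context (R : realType) (d : nat) (disp : measure_display)
  (Omega : measurableType disp) (P : probability Omega R).
Local Notation T := (d.-tuple R).
Local Notation mu := (lebesgue_vec R d).
Variables (X : nat -> {RV P >-> T}) (n : nat).

Lemma measurable_fun_indic (disp' : measure_display) (U : measurableType disp')
    (g : Omega -> U) (K : set U) : measurable K -> measurable_fun setT g ->
  measurable_fun setT (fun w => \1_K (g w) : R).
Proof. by move=> mK mg; apply: (measurableT_comp _ mg); exact: measurable_indic. Qed.

Lemma measurable_hist_coef (K : set (T * T)) : measurable K ->
  measurable_fun setT (fun w => hist_coef n (fun i => X i w) K).
Proof.
move=> mK; rewrite /hist_coef; apply: measurable_funM.
  apply: measurable_sum => i; apply: measurable_fun_indic => //.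
  by apply: measurable_fun_pair.
pose den w := \sum_(i < n) \int[mu]_y (\1_K (X i w, y) : R).
(* The power with exponent -1 is a measurable function and agrees with the inverse on nonnegative
   reals, including at 0, where both are 0. *)
have -> : (fun w => (den w)^-1) = (fun w => den w `^ (-1)).
  apply/funext => w; rewrite powR_inv1//; apply: sumr_ge0 => i _.
  exact: Rintegral_indic_ge0.
apply: (measurableT_comp (measurable_powR (-1))).
apply: measurable_sum => i; rewrite /Rintegral.
apply: measurableT_comp; first exact: fine_measurable.
apply: (measurable_fun_fubini_tonelli_F (fun z : Omega * T => (\1_K (X i z.1, z.2))%:E)).
  apply/measurable_EFinP; apply: measurableT_comp; first exact: measurable_indic.
  by apply: measurable_fun_pair => //; exact: measurableT_comp.
by move=> z; rewrite lee_fin.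
Qed.

Hypothesis d1 : (1 <= d)%N.

Lemma measurable_H2_hist l (m : set (set (T * T))) f : partitions_fin l m ->
  measurable_fun setT f ->
  measurable_fun setT (fun w => H2 n (fun i => X i w) f (hist n (fun i => X i w) m)).
Proof.
move=> ml mf; rewrite /H2; apply: emeasurable_funM; first exact: measurable_cst.
apply: emeasurable_sum => i.
have mX2 : measurable_fun setT (fun z : Omega * T => (X i z.1 : T, z.2)).
  by apply: measurable_fun_pair => //; exact: measurableT_comp.
apply: (measurable_fun_fubini_tonelli_F (fun z : Omega * T =>
  ((Num.sqrt (f (X i z.1, z.2)) -
    Num.sqrt (hist n (fun i => X i z.1) m (X i z.1, z.2))) ^+ 2)%:E)).
  apply: measurable_sqrt_dist; first exact: measurableT_comp.
  apply: (measurable_pw d1 ml (a := fun K (z : Omega * T) =>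
     hist_coef n (fun i => X i z.1) K) mX2) => K mK.
  apply: (measurableT_comp (measurable_hist_coef (partition_measurable d1 ml mK))).
  exact: measurable_fst.
by move=> z; rewrite lee_fin sqr_ge0.
Qed.

Lemma measurable_H2_s_hat L l mhat f : selected X n L (Some l) mhat ->
  measurable_fun setT f ->
  measurable_fun setT (fun w => H2 n (fun i => X i w) f (s_hat X n mhat w)).
Proof.
move=> [mm hm] mf.
apply: (measurable_fun_select
  (G := fun w m => H2 n (fun i => X i w) f (hist n (fun i => X i w) m))
  (finite_partitions R l d1) mm).
- by move=> w; exact: (hm w).1.
- by move=> m hl; exact: measurable_H2_hist hl mf.
Qed.

End measurability.

(** * The risk bound *)

Section infima.
Local Open Scope ereal_scope.
Context (R : realType).

Lemma ereal_inf_sqrte_ge0 (V : Type) (S : set V) (D : V -> \bar R) :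
  0 <= ereal_inf [set sqrte (D g) | g in S].
Proof. by apply/ereal_infP => _ [g _ <-]; exact: sqrte_ge0. Qed.

Lemma ereal_inf_sqrte_le (V : Type) (S : set V) (D : V -> \bar R) g :
  S g -> 0 <= D g -> ereal_inf [set sqrte (D g) | g in S] ^+ 2 <= D g.
Proof.
move=> Sg Dg; rewrite -[leRHS]sqr_sqrte// lee_sqr ?sqrte_ge0 ?ereal_inf_sqrte_ge0//.
by apply: ereal_inf_lbound; exists g.
Qed.

(** The distance to a model is an infimum of square roots, so [x - B] is compared with it after
    taking its own root; this is done when [x - B] is positive, the other case being trivial. *)
Lemma le_ereal_inf_sqrte (V : Type) (S : set V) (D : V -> \bar R) x B :
  (forall g, 0 <= D g) -> 0 <= B -> (forall g, S g -> x <= D g + B) ->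
  x <= ereal_inf [set sqrte (D g) | g in S] ^+ 2 + B.
Proof.
move=> D0 B0 h; set i := ereal_inf _.
have i0 : 0 <= i by exact: ereal_inf_sqrte_ge0.
have i20 : 0 <= i ^+ 2 by rewrite expe_ge0.
have [->|Bfin] := eqVneq B +oo; first by rewrite addey ?leey// gt_eqF// (lt_le_trans _ i20)// ltNyr.
have Bf : B \is a fin_num by rewrite ge0_fin_numE// lt_neqAle Bfin leey.
rewrite -leeBlDr//; have [xB|xB] := leP (x - B) 0; first exact: le_trans i20.
rewrite -[leLHS](sqr_sqrte (ltW xB)) lee_sqr ?sqrte_ge0//.
apply/ereal_infP => _ [g Sg <-]; rewrite lee_sqrt// leeBlDr//.
exact: h.
Qed.

Lemma le_ereal_inf_affine (S : set nat) (r : nat -> \bar R) x A (c : R) :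
  (0 < c)%R -> 0 <= A -> (forall q, S q -> 0 <= r q) ->
  (forall q, S q -> x <= A + c%:E * r q) ->
  x <= A + c%:E * ereal_inf [set r q | q in S].
Proof.
move=> c0 A0 r0 h.
have i0 : 0 <= ereal_inf [set r q | q in S].
  by apply/ereal_infP => _ [q Sq <-]; exact: r0.
have ci0 : 0 <= c%:E * ereal_inf [set r q | q in S] by rewrite mule_ge0// lee_fin ltW.
have [->|Afin] := eqVneq A +oo.
  by rewrite addye ?leey// gt_eqF// (lt_le_trans _ ci0)// ltNyr.
have Af : A \is a fin_num by rewrite ge0_fin_numE// lt_neqAle Afin leey.
rewrite -leeBlDl// -lee_pdivrMl//; apply/ereal_infP => _ [q Sq <-].
by rewrite lee_pdivrMl// leeBlDl//; exact: h.
Qed.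

Lemma triangle_chain (h hf hfs Hfs Ha Hb : \bar R) : 0 <= Ha -> 0 <= Hb ->
  h <= 2%:E * hf + 2%:E * hfs -> hfs <= 16%:E * Hfs ->
  Hfs <= 2%:E * Ha + 2%:E * Hb ->
  h <= 2%:E * hf + (64%:E * Ha + 64%:E * Hb).
Proof.
move=> a0 b0 h1 h2 h3; apply: (le_trans h1); apply: leeD => //.
apply: (@le_trans _ _ (2%:E * (16%:E * (2%:E * Ha + 2%:E * Hb)))).
  apply: lee_wpmul2l; first by rewrite lee_fin.
  by apply: (le_trans h2); apply: lee_wpmul2l; rewrite ?lee_fin.
rewrite ge0_muleDr ?mule_ge0 ?lee_fin// ge0_muleDr ?mule_ge0 ?lee_fin//.
rewrite !muleA -!EFinM; have -> : (2 * 16 * 2 = 64 :> R)%R by ring.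
by [].
Qed.

(** If [x] is finite, the oracle bound makes [EH] finite and at most (x + pn)/C0; substitution gives
    the factor 66 + 64/C0, which also absorbs the 4 before [rho]. If [x] is infinite, so is the
    right-hand side. *)
Lemma risk_arith (x E EH : \bar R) (pn rho C0 : R) : (0 < C0)%R ->
  0 <= x -> (0 <= pn)%R -> (0 <= rho)%R -> 0 <= EH ->
  E <= 66%:E * x + 64%:E * EH + (4 * rho)%:E ->
  C0%:E * EH <= x + pn%:E ->
  ((66 + 64 / C0)^-1)%:E * E <= (x + pn%:E) + rho%:E.
Proof.
move=> C00 x0 pn0 rho0 EH0 h1 h2.
have k0 : (0 < 66 + 64 / C0)%R by rewrite addr_gt0// divr_gt0.
rewrite lee_pdivrMl//.
case: x x0 h1 h2 => [x||]; last by [].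
- move=> x0 h1 h2.
  have [e eE] : exists e, EH = e%:E.
    case: EH EH0 h2 {h1} => [e _ _||//]; first by exists e.
    by rewrite gt0_muley ?lte_fin// -EFinD leye_eq.
  rewrite eE -EFinM -EFinD lee_fin in h2.
  apply: (le_trans h1); rewrite eE -!EFinM -!EFinD lee_fin.
  rewrite lee_fin in x0.
  have h3 : (e <= C0^-1 * (x + pn))%R by rewrite ler_pdivlMl.
  have : (0 <= C0^-1)%R by rewrite invr_ge0 ltW.
  move: (C0^-1)%R h3 => k h3 hk; rewrite -/k.
  have : (0 <= k * rho)%R by rewrite mulr_ge0.
  nra.
- move=> _ _ _; rewrite !addye// gt0_muley ?leey// lte_fin.
Qed.

End infima.

Definition unit_box (R : realType) d : set (d.-tuple R) :=
  [set y | forall i, 0 <= tnth y i <= 1].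

Lemma measurable_unit_box (R : realType) d : measurable (@unit_box R d).
Proof.
rewrite (_ : @unit_box R d = \bigcup_(c in [set: {ffun 'I_d -> 'I_(2 ^ 0)}]) @cell R d 0 c).
  by apply: fin_bigcup_measurable => // c _; exact: measurable_cell.
apply/seteqP; split => y; first by move=> /(cell_ex 0)[c cy]; exists c.
by move=> [c _ cy] i; have [] := cy i.
Qed.

Lemma lebesgue_unit_box (R : realType) d :
  lebesgue_vec R d (@unit_box R d) = 1%E.
Proof.
rewrite (_ : @unit_box R d = [set y : d.-tuple R | forall i, `[0, 1]%classic (tnth y i)]).
  rewrite (lebesgue_vec_box (A := fun=> `[0, 1]%classic)).
    by rewrite big1// => i _; rewrite lebesgue_measure_itv /= lte01 oppr0 adde0.
  by move=> i; exact: measurable_itv.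
by apply/seteqP; split => y h i; have := h i; rewrite /= in_itv.
Qed.

Lemma measurable_unit_cube (R : realType) d : measurable (@unit_cube R d).
Proof.
have [c [c' ->]] : exists c c', @unit_cube R d = @cell R d 0 c `*` @cell R d 0 c'.
  by apply/dyadic_cubesP; exact: dyadic_cubes_unit.
by apply: measurableX; exact: measurable_cell.
Qed.

Lemma ge0_integral_affine (R : realType) (disp : measure_display)
    (Omega : measurableType disp) (P : probability Omega R) (c : \bar R)
    (k K : R) (A B S : Omega -> \bar R) :
  (0 <= c)%E -> 0 <= k -> 0 <= K ->
  (forall w, 0 <= A w)%E -> (forall w, 0 <= B w)%E -> (forall w, 0 <= S w)%E ->
  measurable_fun setT A -> measurable_fun setT B -> measurable_fun setT S ->
  (\int[P]_w (c + (k%:E * A w + k%:E * B w) + K%:E * S w) =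
   c + (k%:E * \int[P]_w A w + k%:E * \int[P]_w B w) + K%:E * \int[P]_w S w)%E.
Proof.
move=> c0 k0 K0 A0 B0 S0 mA mB mS.
have mk (r : R) D : measurable_fun setT D -> measurable_fun setT (fun w : Omega => r%:E * D w)%E.
  by move=> mD; apply: emeasurable_funM => //; exact: measurable_cst.
have mAB : measurable_fun setT (fun w => k%:E * A w + k%:E * B w)%E.
  by apply: emeasurable_funD; exact: mk.
have kE : (0 <= k%:E)%E by rewrite lee_fin.
have KE : (0 <= K%:E)%E by rewrite lee_fin.
rewrite ge0_integralD//; first last.
- exact: mk.
- by move=> w _; rewrite mule_ge0.
- by apply: emeasurable_funD => //; exact: measurable_cst.
- by move=> w _; rewrite !adde_ge0// mule_ge0.
rewrite ge0_integralD//; last by move=> w _; rewrite adde_ge0// mule_ge0.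
rewrite ge0_integralD//; first last.
- exact: mk.
- by move=> w _; rewrite mule_ge0.
- exact: mk.
- by move=> w _; rewrite mule_ge0.
have -> : (\int[P]_w c = c)%E.
  rewrite integral_cst// -[RHS]mule1; congr (_ * _)%E; exact: probability_setT.
by rewrite !ge0_integralZl_EFin.
Qed.

Section risk.
Context (R : realType) (d n : nat) (disp : measure_display)
  (Omega : measurableType disp) (P : probability Omega R)
  (X : nat -> {RV P >-> d.-tuple R}) (s : d.-tuple R * d.-tuple R -> R)
  (phi : d.-tuple R -> R) (kappa0 : R) (l : nat) (L : R)
  (mhat : Omega -> set (set (d.-tuple R * d.-tuple R))).
Local Notation T := (d.-tuple R).
Local Notation mu := (lebesgue_vec R d).
Local Notation idx := {ffun 'I_d -> 'I_(2 ^ l)}.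
Local Notation data w := (fun i => X i w).
Local Notation sA := (restr s (@unit_cube R d)).
Hypotheses (d1 : (1 <= d)%N) (n0 : (0 < n)%N) (mX : markov_chain X s)
  (sX : stationary X) (phiX : has_density (X 0%N) phi) (k0 : 0 < kappa0)
  (kphi : forall x, @unit_box R d x -> kappa0 <= phi x)
  (hmhat : selected X n L (Some l) mhat).

Let mphi : measurable_fun setT phi. Proof. by case: phiX. Qed.
Let phi0 x : 0 <= phi x. Proof. by case: phiX. Qed.
Let ms : measurable_fun setT s. Proof. by case: mX => -[]. Qed.
Let s0 z : 0 <= s z. Proof. by case: mX => -[]. Qed.
Let s1 x : (\int[mu]_y (s (x, y))%:E = 1)%E. Proof. by case: mX => -[]. Qed.

Let phi1 : (\int[mu]_x (phi x)%:E = 1)%E.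
Proof.
by rewrite -(stationary_prob sX phiX 0 measurableT) preimage_setT probability_setT.
Qed.

Let msA : measurable_fun setT sA.
Proof.
apply: measurable_funM => //; apply: measurable_indic.
exact: measurable_unit_cube.
Qed.

Let sA0 z : 0 <= sA z. Proof. by rewrite /restr mulr_ge0. Qed.

Let sA_supp : supp_unit sA.
Proof. by move=> z zu; rewrite /restr indicE memNset ?mulr0. Qed.

Let pr c := fine (P (X 0%N @^-1` @cell R d l c)).

Let bad (c : idx) := [set w | (occupation X (cell c) n w)%:R < n%:R * pr c / 16].

Let mbad c : measurable (bad c).
Proof. exact: (measurable_occupation X (measurable_cell c) n (fun j => j%:R < _)). Qed.

Let prE c : (\int[mu]_(y in @cell R d l c) (phi y)%:E = (pr c)%:E)%E.
Proof.
rewrite -(stationary_prob sX phiX 0 (measurable_cell c)) fineK//.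
by rewrite fin_num_measure//; apply: measurable_funPTI => //; exact: measurable_cell.
Qed.

Let pr_ge c : kappa0 / 2 ^+ (l * d) <= pr c.
Proof.
rewrite -lee_fin -prE EFinM -(lebesgue_cell R c).
rewrite -[leLHS]integral_cst; last exact: measurable_cell.
apply: ge0_le_integral; first exact: measurable_cell.
- by move=> x _; rewrite lee_fin ltW.
- exact: measurable_cst.
- by apply: measurable_funTS; exact/measurable_EFinP.
- by move=> x cx; rewrite lee_fin; apply: kphi => i; have [] := cx i.
Qed.

Let supp_pw (m : set (set (T * T))) f : partitions_fin l m -> pw_const m f -> supp_unit f.
Proof. by move=> ml fm z; apply: (pw_const_supp d1 ml fm). Qed.

(** Sections of [sA] have mass at most 1, and those of the estimator at most 2^(ld), its upper bound
    on a box of volume 1. Half the sum of the two is at most 2^(ld). *)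
Lemma h2_s_hat_le w : (h2 phi sA (s_hat X n mhat w) <= (2 ^+ (l * d))%:E)%E.
Proof.
have ml : partitions_fin l (mhat w) := ((hmhat.2) w).1.
have hp := hist_pw_const (mhat w) n (data w).
apply: (@le_trans _ _ (2^-1 * (1 + 2 ^+ (l * d)))%:E); last first.
  rewrite lee_fin; have : (1 : R) <= 2 ^+ (l * d) by rewrite exprn_ege1// ler1n.
  lra.
apply: h2_le_mass => //.
- exact: (pw_const_measurable d1 ml hp).
- exact: supp_pw ml hp.
- by move=> z; exact: (pw_const_ge0 z hp).
- move=> x; rewrite -(s1 x); apply: ge0_le_integral_nonmeas => y.
    by rewrite lee_fin.
  by rewrite lee_fin /restr indicE; case: (_ \in _); rewrite ?mulr1 ?mulr0.
- move=> x; apply: (@le_trans _ _ (\int[mu]_y ((2 ^+ (l * d))%:E * (\1_(@unit_box R d) y)%:E))%E).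
    apply: ge0_le_integral_nonmeas => y.
      by rewrite lee_fin; exact: (pw_const_ge0 _ hp).
    rewrite -EFinM lee_fin indicE; case: (boolP (y \in _)) => [_|].
      rewrite mulr1; exact: (hist_le d1 ml).
    rewrite notin_setE => yn; rewrite mulr0.
    have -> // : s_hat X n mhat w (x, y) = 0.
    apply: (supp_pw ml hp) => h; apply: yn => i; have [_] := h i; exact.
  rewrite ge0_integralZl_EFin//; last first.
    by apply: measurable_EFin_indic; exact: measurable_unit_box.
  rewrite integral_indic//; last exact: measurable_unit_box.
  by rewrite setIT [X in (_ * X)%E](lebesgue_unit_box R d) mule1.
Qed.

(** The sum of indicators is at least 1 as soon as one cell is visited too rarely. Putting it in a
    pointwise bound avoids splitting the expectation, and integration yields the union bound over
    cells. *)
Lemma h2_s_hat_pointwise (m : set (set (T * T))) f w : partitions_fin l m -> pw_const m f ->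
  (h2 phi sA (s_hat X n mhat w) <=
   (2%:E * h2 phi sA f + (64%:E * H2 n (data w) sA f +
     64%:E * H2 n (data w) sA (s_hat X n mhat w))) +
   (2 ^+ (l * d))%:E * \sum_(c : idx) (\1_(bad c) w)%:E)%E.
Proof.
move=> ml fm; have ml' : partitions_fin l (mhat w) := ((hmhat.2) w).1.
have hp := hist_pw_const (mhat w) n (data w).
have mf := pw_const_measurable d1 ml fm.
have mh := pw_const_measurable d1 ml' hp.
have sf := supp_pw ml fm; have sh := supp_pw ml' hp.
have h20 g g' : (0 <= h2 phi g g')%E.
  rewrite mule_ge0 ?lee_fin ?invr_ge0//; apply: integral_ge0 => z _.
  by rewrite lee_fin mulr_ge0 ?sqr_ge0.
have S0 : (0 <= 2%:E * h2 phi sA f + (64%:E * H2 n (data w) sA f +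
     64%:E * H2 n (data w) sA (s_hat X n mhat w)))%E.
  by rewrite !adde_ge0// mule_ge0 ?H2_ge0.
have B0 : (0 <= \sum_(c : idx) (\1_(bad c) w)%:E :> \bar R)%E.
  by apply: sume_ge0 => c _; rewrite lee_fin.
have [[c wc]|good] := pselect (exists c, bad c w).
  apply: (le_trans (h2_s_hat_le w)); rewrite -[leLHS]add0e; apply: leeD => //.
  rewrite -[leLHS]mule1; apply: lee_wpmul2l; first by rewrite lee_fin exprn_ge0.
  rewrite (bigD1 c)//= indicE mem_set// -[leLHS]adde0 leeD//.
  by apply: sume_ge0 => c' _; rewrite lee_fin.
rewrite -[leLHS]adde0; apply: leeD; last by rewrite mule_ge0// lee_fin exprn_ge0.
apply: (@triangle_chain _ _ _ (h2 phi f (s_hat X n mhat w))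
  (H2 n (data w) f (s_hat X n mhat w))); rewrite ?H2_ge0//.
- exact: h2_triangle.
- apply: (@h2_le_H2 _ _ l n phi (data w) f _ pr) => //.
  + by move=> c y y' z cy cy'; exact: (pw_const_cell d1 ml z fm cy cy').
  + by move=> c y y' z cy cy'; exact: (pw_const_cell d1 ml' z hp cy cy').
  + by move=> c; rewrite leNgt; apply/negP => wc; apply: good; exists c.
- rewrite (H2_sym _ _ sA f); exact: H2_triangle.
Qed.

Lemma integrated_risk_le (m : set (set (T * T))) f q sq b : (0 < q)%N -> (q <= n)%N ->
  cond_density (X 0%N) (X q) sq -> beta_coef sq phi = b%:E ->
  partitions_fin l m -> pw_const m f ->
  (\int[P]_w h2 phi sA (s_hat X n mhat w) <=
   66%:E * h2 phi sA f +
   64%:E * \int[P]_w H2 n (data w) sA (s_hat X n mhat w) +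
   (4 * (2 ^+ (3 * l * d) *
     (expR (- (kappa0 / 10 * (n%:R / (q%:R * 2 ^+ (l * d))))) + n%:R * b * q%:R^-1)))%:E)%E.
Proof.
move=> q0 qn sqX bE ml fm; set r := expR _ + _.
have mf := pw_const_measurable d1 ml fm; have sf := supp_pw ml fm.
have h20 g : (0 <= h2 phi sA g)%E.
  rewrite mule_ge0 ?lee_fin ?invr_ge0//; apply: integral_ge0 => z _.
  by rewrite lee_fin mulr_ge0 ?sqr_ge0.
have b0 : 0 <= b.
  rewrite -lee_fin -bE; apply: integral_ge0 => z _; rewrite lee_fin mulr_ge0//.
have r0 : 0 <= r by rewrite addr_ge0 ?expR_ge0// !mulr_ge0// invr_ge0.
have mS : measurable_fun setT (fun w => \sum_(c : idx) (\1_(bad c) w)%:E : \bar R)%E.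
  by apply: emeasurable_sum => c; exact: measurable_EFin_indic.
have S0 w : (0 <= \sum_(c : idx) (\1_(bad c) w)%:E :> \bar R)%E.
  by apply: sume_ge0 => c _; rewrite lee_fin.
have mHf : measurable_fun setT (fun w => H2 n (data w) sA f).
  rewrite /H2; apply: emeasurable_funM; first exact: measurable_cst.
  apply: emeasurable_sum => i.
  exact: (measurableT_comp (measurable_hell_sect msA mf)).
have mHs := measurable_H2_s_hat d1 hmhat msA.
apply: (le_trans (ge0_le_integral_nonmeas P
  (fun w => h20 _) (fun w => h2_s_hat_pointwise w ml fm))).
rewrite (ge0_integral_affine (c := (2%:E * h2 phi sA f)%E) P (A := fun w => H2 n (data w) sA f)
  (B := fun w => H2 n (data w) sA (s_hat X n mhat w))
  (S := fun w => (\sum_(c : idx) (\1_(bad c) w)%:E)%E)) ?exprn_ge0//; first last.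
- by move=> w; exact: H2_ge0.
- by move=> w; exact: H2_ge0.
- by rewrite mule_ge0.
(* [sA] and [f] are deterministic, so 64 times the expected [H2] between them joins 2 times [h2] to
   give 66. *)
rewrite (expectation_H2 sX phiX n0 msA mf sA_supp sf) addeA.
apply: leeD.
  rewrite leeD2r// -ge0_muleDl// -EFinD.
  by have -> : (2 + 64 = 66 :> R) by ring.
rewrite ge0_integral_sum//; last first.
  by move=> c; exact: measurable_EFin_indic.
apply: (@le_trans _ _ ((2 ^+ (l * d))%:E * \sum_(c : idx) (4 * r)%:E)%E).
  apply: lee_wpmul2l; first by rewrite lee_fin exprn_ge0.
  apply: lee_sum => c _; rewrite integral_indic// setIT.
  rewrite -[X in (X <= _)%E]fineK ?fin_num_measure// lee_fin.
  have k20 : 0 < kappa0 / 2 ^+ (l * d) by rewrite divr_gt0// exprn_gt0.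
  apply: (le_trans (occupation_deviation_explicit (measurable_cell c) mX sX phiX
    sqX bE q0 qn k20 (pr_ge c))).
  rewrite /r invfM !mulrA.
  by have -> : kappa0 / 2 ^+ (l * d) / 10 * n%:R / q%:R =
     kappa0 / 10 * n%:R / q%:R / 2 ^+ (l * d) by ring.
rewrite sumEFin sumr_const card_ffun !card_ord -EFinM lee_fin -[_ *+ _ ^ _]mulr_natl.
rewrite natrX natrX -exprM.
have -> : (2 : R) ^+ (3 * l * d) = 2 ^+ (l * d) * (2 ^+ (l * d) * 2 ^+ (l * d)).
  by rewrite -!exprD; congr (_ ^+ _); lia.
have : 1 <= (2 : R) ^+ (l * d) by rewrite exprn_ege1// ler1n.
(* One factor [a] bounds the loss off the good event, another counts the cells; the third is
   inserted using 1 <= a. *)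
move: (2 ^+ (l * d)) => a a1.
have -> : a * (a * (4 * r)) = 4 * (1 * (a * a) * r) by ring.
rewrite ler_pM2l// ler_wpM2r// ler_wpM2r//.
by rewrite mulr_ge0// (le_trans ler01).
Qed.

End risk.

Theorem theorem3 (R : realType) (L0 : R) (hL0 : oracle_constant L0) :
  exists2 C : R, 0 < C &
  forall (d n : nat) (disp : measure_display) (Omega : measurableType disp)
    (P : probability Omega R) (X : nat -> {RV P >-> d.-tuple R})
    (s : d.-tuple R * d.-tuple R -> R) (phi : d.-tuple R -> R) (kappa0 : R)
    (sq : nat -> d.-tuple R * d.-tuple R -> R) (l : nat) (L : R)
    (mhat : Omega -> set (set (d.-tuple R * d.-tuple R))),
  (1 <= d)%N -> (3 < n)%N ->
  markov_chain X s ->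
  stationary X -> has_density (X 0%N) phi ->
  0 < kappa0 ->
  (forall x : d.-tuple R, (forall i, 0 <= tnth x i <= 1) -> kappa0 <= phi x) ->
  (forall q, (1 <= q)%N -> cond_density (X 0%N) (X q) (sq q)) ->
  (1 <= l)%N -> L0 <= L ->
  selected X n L (Some l) mhat ->
  let sA := restr s (@unit_cube R d) in
  (C%:E * \int[P]_w h2 phi sA (s_hat X n mhat w) <=
   ereal_inf [set (h_dist phi sA (pw_const m)) ^+ 2 + (pen n L m)%:E
             | m in @partitions R d (Some l)]
   + remainder d n l kappa0 (fun q => beta_coef (sq q) phi) * (n%:R^-1)%:E)%E.
Proof.
have [L00 [C0 C00 oracle]] := hL0.
(* The constant depends on [C0] alone, hence is universal. *)
exists (66 + 64 / C0)^-1; first by rewrite invr_gt0 addr_gt0// divr_gt0.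
move=> d n disp Omega P X s phi kappa0 sq l L mhat d1 n3 mX sX phiX k0 kphi hsq l1 LL hm.
cbv zeta; set sA := restr s _.
have n0 : (0 < n)%N by apply: leq_ltn_trans n3.
have nR : 0 < n%:R :> R by rewrite ltr0n.
have [mphi phi0 _] := phiX.
have pen0 m : 0 <= @pen R d n L m.
  rewrite /pen !mulr_ge0// ?invr_ge0 ?ler0n//; first exact: ltW (lt_le_trans L00 LL).
  by rewrite ln_ge0// ler1n.
pose r q := ((expR (- (kappa0 / 10 * (n%:R / (q%:R * 2 ^+ (l * d))))))%:E
  + n%:R%:E * beta_coef (sq q) phi * (q%:R^-1)%:E)%E.
have beta0 q : (0 <= beta_coef (sq q) phi)%E.
  by apply: integral_ge0 => z _; rewrite lee_fin mulr_ge0.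
have r0 q : (0 <= r q)%E.
  by rewrite adde_ge0 ?lee_fin ?expR_ge0// !mule_ge0 ?lee_fin ?invr_ge0.
have c0 : 0 < (2 : R) ^+ (3 * l * d) by rewrite exprn_gt0.
have -> : (remainder d n l kappa0 (fun q => beta_coef (sq q) phi) * (n%:R^-1)%:E =
    (2 ^+ (3 * l * d))%:E * ereal_inf [set r q | q in [set q | (1 <= q <= n)%N]])%E.
  rewrite /remainder -/r muleAC -EFinM; congr (_%:E * _)%E.
  by rewrite mulrAC divff ?mul1r// gt_eqF.
set rem := ((2 ^+ (3 * l * d))%:E * _)%E.
have rem0 : (0 <= rem)%E.
  apply: mule_ge0; first by rewrite lee_fin ltW.
  apply/ereal_infP => _ [q _ <-]; exact: r0.
have h20 g : (0 <= h2 phi sA g)%E.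
  rewrite mule_ge0 ?lee_fin ?invr_ge0//; apply: integral_ge0 => z _.
  by rewrite lee_fin mulr_ge0 ?sqr_ge0.
have C1 : 0 < (66 + 64 / C0)^-1 by rewrite invr_gt0 addr_gt0// divr_gt0.
set E := (\int[P]_w _)%E.
(* The bound is proved for each choice of [m], [f] and [q]; the infima are taken afterwards, over
   [q], then [f], then [m]. *)
have Einf m f q : partitions_fin l m -> pw_const m f -> (1 <= q <= n)%N ->
    ((66 + 64 / C0)^-1%:E * E <=
     (h2 phi sA f + (pen n L m)%:E) + (2 ^+ (3 * l * d))%:E * r q)%E.
  move=> ml fm /andP[q1 qn].
  have S0 : (0 <= h2 phi sA f + (pen n L m)%:E)%E by rewrite adde_ge0 ?lee_fin ?pen0.
  (* An infinite coefficient would make the right-hand side infinite; otherwise beta_q is a real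
     number, as the mixing bounds require. *)
  have [bfin|] := boolP (beta_coef (sq q) phi \is a fin_num); last first.
    rewrite ge0_fin_numE// -leNgt leye_eq => /eqP binf.
    rewrite /r binf gt0_muley ?lte_fin// gt0_mulye ?lte_fin ?invr_gt0 ?ltr0n//.
    by rewrite addey// gt0_muley ?lte_fin// addey ?leey// gt_eqF// (lt_le_trans _ S0)// ltNyr.
  have bE : beta_coef (sq q) phi = (fine (beta_coef (sq q) phi))%:E by rewrite fineK.
  have b0 : 0 <= fine (beta_coef (sq q) phi) by exact: fine_ge0.
  rewrite /r bE -!EFinM.
  have f0 := h20 f.
  apply: (risk_arith (EH := (\int[P]_w H2 n (fun i => X i w) sA (s_hat X n mhat w))%E)) => //.
  - apply: mulr_ge0; first exact: ltW.
    by rewrite addr_ge0 ?expR_ge0// !mulr_ge0// invr_ge0.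
  - by apply: integral_ge0 => w _; exact: H2_ge0.
  - exact: (integrated_risk_le d1 n0 mX sX phiX k0 kphi hm q1 qn (hsq q q1) bE ml fm).
  have lN : Some l != Some 0%N by rewrite (inj_eq Some_inj) -lt0n.
  apply: (le_trans (oracle d n disp Omega P X s L (Some l) mhat d1 n3 mX LL lN hm)).
  (* The oracle infimum is at most its term at [m]; there the squared distance to the model is at
     most [H2] between [sA] and [f], whose expectation is [h2 phi sA f]. *)
  apply: (@le_trans _ _ (\int[P]_w (H_dist n (fun i => X i w) sA (pw_const m)) ^+ 2 + (pen n L m)%:E)%E).
    by apply: ereal_inf_lbound; exists m.
  rewrite leeD2r//.
  have mf := pw_const_measurable d1 ml fm.
  have msA : measurable_fun setT sA.
    have [[ms _ _] _] := mX; apply: measurable_funM => //.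
    by apply: measurable_indic; exact: measurable_unit_cube.
  rewrite -(expectation_H2 sX phiX n0 msA mf); last 2 first.
  - by move=> z zu; rewrite /sA /restr indicE memNset ?mulr0.
  - by move=> z zu; exact: (pw_const_supp d1 ml fm zu).
  apply: ge0_le_integral_nonmeas => w; first by rewrite expe_ge0// ereal_inf_sqrte_ge0.
  by apply: ereal_inf_sqrte_le => //; exact: H2_ge0.
have step m f : partitions_fin l m -> pw_const m f ->
    ((66 + 64 / C0)^-1%:E * E <= (h2 phi sA f + (pen n L m)%:E) + rem)%E.
  move=> ml fm; apply: le_ereal_inf_affine => //; first by rewrite adde_ge0 ?lee_fin ?pen0.
  by move=> q hq; exact: Einf.
have E0 : (0 <= E)%E by apply: integral_ge0.
have step2 m : partitions_fin l m ->
    ((66 + 64 / C0)^-1%:E * E <= ((h_dist phi sA (pw_const m)) ^+ 2 + (pen n L m)%:E) + rem)%E.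
  move=> ml; rewrite -addeA; apply: le_ereal_inf_sqrte => //; first by rewrite adde_ge0 ?lee_fin ?pen0.
  by move=> f fm; rewrite addeA; exact: step.
have I0 : (0 <= ereal_inf [set h_dist phi sA (pw_const m) ^+ 2 + (pen n L m)%:E | m in @partitions R d (Some l)])%E.
  by apply/ereal_infP => _ [m _ <-]; rewrite adde_ge0 ?lee_fin ?pen0 ?expe_ge0 ?ereal_inf_sqrte_ge0.
have [->|remfin] := eqVneq rem +oo%E.
  by rewrite addey ?leey// gt_eqF// (lt_le_trans _ I0)// ltNyr.
have remf : rem \is a fin_num by rewrite ge0_fin_numE// lt_neqAle remfin leey.
rewrite -leeBlDr//; apply/ereal_infP => _ [m ml <-].
by rewrite leeBlDr//; exact: step2.
Qed.
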